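(* Let $l,r>0$ and let $F_L=\beta(1,l)$, $F_R=\beta(1,r)$. Let $p:[0,1]\to[0,1]$ be piecewise continuous on $[0,1]$ and suppose that, for some $\delta\in(0,1/2)$, $$\sup_{x\in[0,\delta]}\max\{p(x),\,1-p(1-x)\}<1.$$ Let $X=\{X_n\}_{n\ge0}$ be the Markov chain on $[0,1]$ described in the context. Then $X$ is ergodic with stationary density $$\pi(x)=C\,x^{l}\left(\frac{r}{1-x}+\frac{l}{x}\right)\exp\left(-r\int_{1/2}^x\frac{p(t)}{1-t}\,dt-l\int_{1/2}^x\frac{p(t)}{t}\,dt\right),\qquad 0<x<1,$$ where $C>0$ is a normalising constant such that $\int_0^1\pi(x)\,dx=1$.
   Context: The chain $X=\{X_n\}_{n\ge0}$ is defined by $X_0=x_0\in[0,1]$ and $$X_{n+1}=X_n-X_nL_{n+1}I_{n+1}+(1-X_n)R_{n+1}(1-I_{n+1}),\qquad n=0,1,\ldots,$$ where $I_{n+1}:=\mathbf{1}_{\{U_{n+1}<p(X_n)\}}$ ($\mathbf{1}_A$ is the indicator of the event $A$), and $\{L_n\}_{n\ge1}$, $\{R_n\}_{n\ge1}$, $\{U_n\}_{n\ge1}$ are independent sequences of i.i.d. random variables with $L_n\sim F_L$, $R_n\sim F_R$, and $U_n$ uniform on $[0,1]$. $\beta(a,b)$, $a,b>0$, denotes the beta distribution with density $x^{a-1}(1-x)^{b-1}/B(a,b)$, $0<x<1$, where $B(a,b)$ is the beta function. Piecewise continuous means: continuous except at finitely many points, with finite one-sided limits there. Ergodicity is meant in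 the usual sense for Harris chains: there is a unique stationary probability distribution $\Pi$ on $[0,1]$ and, for every starting point $x_0\in[0,1]$, the law of $X_n$ converges to $\Pi$ in total variation as $n\to\infty$. The stationary density is the Lebesgue density of $\Pi$. *)

(* Defs.v *)
(* Setting: MathComp-Analysis, over an arbitrary realType. *)
From HB Require Import structures.
From mathcomp Require Import all_boot all_order all_algebra.
From mathcomp Require Import all_classical all_reals all_analysis.
From mathcomp Require Import measurable_realfun.

Set Implicit Arguments.
Unset Strict Implicit.
Unset Printing Implicit Defensive.

Import Order.TTheory GRing.Theory Num.Theory.
Import numFieldTopology.Exports numFieldNormedType.Exports.

Local Open Scope classical_set_scope.
Local Open Scope ring_scope.

(* The library's beta distribution only allows parameters in nat. *)
Section real_beta.
Context {R : realType}.
Local Notation mu := (@lebesgue_measure R).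
Implicit Types (a b x : R).

Definition rbeta_fun a b : R :=
  \int[mu]_(x in `]0, 1[) (x `^ (a - 1) * (1 - x) `^ (b - 1)).

Definition rbeta_pdf a b x : R :=
  if 0 < x < 1 then x `^ (a - 1) * (1 - x) `^ (b - 1) / rbeta_fun a b else 0.

Definition rbeta_law a b : set (measurableTypeR R) -> \bar R :=
  fun A => (\int[mu]_(x in A) (rbeta_pdf a b x)%:E)%E.

Lemma rbeta_fun_ge0 a b : 0 <= rbeta_fun a b.
Proof.
by apply: Rintegral_ge0 => x _; rewrite mulr_ge0 ?powR_ge0.
Qed.

Lemma rbeta_pdf_ge0 a b x : 0 <= rbeta_pdf a b x.
Proof.
rewrite /rbeta_pdf; case: ifP => // _.
by rewrite !mulr_ge0 ?powR_ge0 ?invr_ge0 ?rbeta_fun_ge0.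
Qed.

Lemma measurable_rbeta_pdf a b : measurable_fun setT (rbeta_pdf a b).
Proof.
apply: measurable_fun_if => //=.
  by apply: measurable_and => //; exact: measurable_fun_ltr.
apply: measurable_funM => //; apply: measurable_funM.
  by apply: measurable_funTS; exact: measurable_powR.
apply: measurable_funTS.
apply: (measurableT_comp (f := @powR R ^~ (b - 1))); first exact: measurable_powR.
exact: measurable_funB.
Qed.

Section measure_instance.
Variables a b : R.

Let law0 : rbeta_law a b set0 = 0%E.
Proof. by rewrite /rbeta_law integral_set0. Qed.

Let law_ge0 A : (0 <= rbeta_law a b A)%E.
Proof. by apply: integral_ge0 => x _; rewrite lee_fin rbeta_pdf_ge0. Qed.

Let law_sigma_additive : semi_sigma_additive (rbeta_law a b).
Proof.
move=> /= F mF tF mUF; rewrite /rbeta_law; apply: cvg_toP.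
  apply: ereal_nondecreasing_is_cvgn => m n mn.
  by apply: lee_sum_nneg_natr => // k _ _; exact: law_ge0.
rewrite ge0_integral_bigcup//=.
- apply: measurable_funTS; apply: measurableT_comp => //.
  exact: measurable_rbeta_pdf.
- by move=> x _; rewrite lee_fin rbeta_pdf_ge0.
Qed.

HB.instance Definition _ := isMeasure.Build _ _ _ (rbeta_law a b)
  law0 law_ge0 law_sigma_additive.

End measure_instance.
End real_beta.

(* Continuity at a point is relative to [a, b]; the exceptional points
   may be endpoints, where only the inner one-sided limit is required. *)
Definition piecewise_continuous_on {R : realType} (a b : R) (f : R -> R) :=
  exists s : seq R,
    (forall x, x \in `[a, b] -> x \notin s ->
       f t @[t --> within `[a, b] (nbhs x)] --> f x) /\
    (forall x, x \in s ->
       (x \in `[a, b[ -> cvg (f t @[t --> x^'+])) /\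
       (x \in `]a, b] -> cvg (f t @[t --> x^'-]))).

Definition mutually_independent d (T : measurableType d) (R : realType)
    (P : probability T R) (I : choiceType) (X : I -> {RV P >-> R}) :=
  forall (J : seq I) (A : I -> set R), uniq J ->
    (forall i, i \in J -> measurable (A i)) ->
    P (\bigcap_(i in [set` J]) (X i @^-1` A i)) =
    (\prod_(i <- J) P (X i @^-1` A i))%E.

Section chain.
Context {R : realType}.
Implicit Types (p : R -> R) (x : R).

(* One transition from x with innovations (L, R, U) = (lam, rho, u).
   Only the values of p on [0, 1] are used: p is cut off to 0 elsewhere, so
   that the step is measurable even on the null event where L or R lies
   outside [0, 1]. *)
Definition chain_step p x (lam rho u : R) : R :=
  let I : R := \1_[set v | v < if x \in `[0, 1] then p x else 0] u in
  x - x * lam * I + (1 - x) * rho * (1 - I).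

(* L n, Rr n, U n stand for the innovations with index n + 1. *)
Fixpoint chain (T : Type) p (L Rr U : nat -> T -> R) x (n : nat) (w : T) : R :=
  if n is m.+1 then
    chain_step p (chain p L Rr U x m w) (L m w) (Rr m w) (U m w)
  else x.

(* The three sequences as a single family, to state joint independence. *)
Definition innovations (V : Type) (L Rr U : nat -> V) (i : nat + nat + nat) : V :=
  match i with
  | inl (inl n) => L n
  | inl (inr n) => Rr n
  | inr n => U n
  end.

(* Law of the chain after one transition from x. *)
Definition transition (l r : R) p x : set (measurableTypeR R) -> \bar R :=
  pushforward
    ((rbeta_law 1 l \x rbeta_law 1 r) \x uniform_prob (@ltr01 R))%E
    (fun v : measurableTypeR R * measurableTypeR R * measurableTypeR R =>
       chain_step p x v.1.1 v.1.2 v.2 : measurableTypeR R).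

Definition stationary (K : R -> set (measurableTypeR R) -> \bar R)
    (Pi : probability (measurableTypeR R) R) :=
  Pi `[0%R, 1%R]%classic = 1%E /\
  forall A, measurable A -> (\int[Pi]_(x in `[0%R, 1%R]) K x A = Pi A)%E.

Definition total_variation_dist (m1 m2 : set (measurableTypeR R) -> \bar R) :=
  ereal_sup [set `|m1 A - m2 A|%E | A in measurable].

(* law x n is the law at time n of the chain started at x. *)
Definition ergodic_with (K : R -> set (measurableTypeR R) -> \bar R)
    (law : R -> nat -> set (measurableTypeR R) -> \bar R)
    (Pi : probability (measurableTypeR R) R) :=
  [/\ stationary K Pi,
      (forall Pi' : probability (measurableTypeR R) R, stationary K Pi' ->
         forall A, measurable A -> Pi' A = Pi A) &
      forall x, x \in `[0, 1] ->
        total_variation_dist (law x n) Pi @[n --> \oo] --> 0%E].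

Definition oriented_integral (a b : R) (f : R -> R) : R :=
  if a <= b then \int[lebesgue_measure]_(t in `[a, b]) f t
  else - \int[lebesgue_measure]_(t in `[b, a]) f t.

Definition stationary_density (l r : R) p (C x : R) : R :=
  C * x `^ l * (r / (1 - x) + l / x) *
  expR (- r * oriented_integral (1 / 2) x (fun t => p t / (1 - t))
        - l * oriented_integral (1 / 2) x (fun t => p t / t)).

End chain.

(* Main.v *)
Require Import Defs.
From HB Require Import structures.
From mathcomp Require Import all_boot all_order all_algebra.
From mathcomp Require Import all_classical all_reals all_analysis.
From mathcomp Require Import measurable_realfun ring lra.

Set Implicit Arguments.
Unset Strict Implicit.
Unset Printing Implicit Defensive.

Import Order.TTheory GRing.Theory Num.Theory.
Import numFieldTopology.Exports numFieldNormedType.Exports.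
Local Open Scope classical_set_scope.
Local Open Scope ring_scope.

(** From [x] the chain jumps to the left with probability [p x], landing at [y]
with density [l y^(l-1) / x^l] on [(0, x)], and otherwise to the right, with
density [r (1-y)^(r-1) / (1-x)^r] on [(x, 1)] ([step_op_density]).  Both
densities are a function of [y] times a function of [x], and this is what makes
the invariant density explicit.

Stationarity.  Put [h x = r/(1-x) + l/x], [H x = l ln x - r ln (1-x)] (a
primitive of [h]) and let [phi] be the primitive of [p h] that vanishes at 1/2.
With [E = exp (- phi)] and [G = exp (H - phi)] one has [E' = - p h E] and
[G' = (1 - p) h G].  Since [p] is bounded away from 0 near 1 and away from 1
near 0, [E] vanishes at 1 and [G] vanishes at 0, hence the integral of [p h E]
over [(y, 1)] is [E y] and that of [(1 - p) h G] over [(0, y)] is [G y]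
([integral_left_tail], [integral_right_head]).  The weight [w = x^l h E]
satisfies [p w / x^l = p h E] and [(1-p) w / (1-x)^r = (1-p) h G], so, exchanging
the order of integration, the mass that one step of the chain carries from [w]
to [y] is [l y^(l-1) E y + r (1-y)^(r-1) G y], which is [w y]
([weight_balance], [weight_invariant]).  The same two identities bound the
integral of [w] ([integral_weight_lty]).  As [p] is only piecewise continuous,
[E] and [G] need not be differentiable everywhere; the two integral identities
come from [integral_mul_expR], which needs nothing but a bounded measurable
integrand.

Ergodicity.  Two steps of the chain satisfy a Doeblin condition on all of
[[0, 1]]: near an endpoint the chain jumps away from it with probability at
least [eps], from the middle it jumps towards one of the endpoints with
probability at least 1/2, and in each case the landing density is bounded below
([two_step_minorization]).  Hence two steps contract the oscillation of every
bounded function by a fixed factor ([doeblin_contraction]), so two evolutions of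
laws approach each other geometrically and uniformly over events
([doeblin_evolves]).  Applied to the law of the chain and to stationary laws,
this yields convergence in total variation and uniqueness.  That the law of the
chain evolves by the transition kernel is where independence of the innovations
is used ([chain_law_evolves]). *)

(** * Densities, affine changes of variable and triangles *)

Section density.
Local Open Scope ereal_scope.
Context d (T : measurableType d) (R : realType).
Variables (m mu : {measure set T -> \bar R}) (q : T -> R).
Hypotheses (q0 : forall x, (0 <= q x)%R) (mq : measurable_fun setT q).
Hypothesis mE : forall A, measurable A -> m A = \int[mu]_(x in A) (q x)%:E.

Import HBNNSimple.

Let integral_density_nnsfun (h : {nnsfun T >-> R}) :
  \int[m]_x (h x)%:E = \int[mu]_x ((h x)%:E * (q x)%:E).
Proof.
have mqE : measurable_fun setT (EFin \o q) by exact/measurable_EFinP.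
under eq_integral do rewrite fimfunE -fsumEFin//.
rewrite ge0_integral_fsum//; last 2 first.
  - by move=> r; exact/measurable_EFinP/measurableT_comp.
  - by move=> r x _; rewrite EFinM nnfun_muleindic_ge0.
under [RHS]eq_integral => x _.
  rewrite fimfunE -fsumEFin// ge0_mule_fsuml; last first.
    by move=> r; rewrite EFinM nnfun_muleindic_ge0.
  over.
rewrite [RHS]ge0_integral_fsum//; last 2 first.
  - move=> r; apply: emeasurable_funM => //.
    by apply/measurable_EFinP; exact/measurableT_comp.
  - by move=> r x _; rewrite EFinM mule_ge0 ?nnfun_muleindic_ge0// lee_fin.
apply: eq_fsbigr => r /set_mem[t _ <-].
under eq_integral do rewrite EFinM.
under [RHS]eq_integral do rewrite EFinM -muleA.
rewrite integralZl_indic_nnsfun// ge0_integralZl//; last 3 first.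
  - by apply: emeasurable_funM => //; exact/measurable_EFinP.
  - by move=> x _; rewrite mule_ge0 ?lee_fin.
  - by rewrite lee_fin.
congr (_ * _); rewrite integral_indic// setIT mE// [LHS]integral_mkcond.
apply: eq_integral => x _; rewrite patchE indicE muleC.
by case: ifPn => _; rewrite ?mule1 ?mule0.
Qed.

Lemma ge0_integral_density (f : T -> \bar R) :
  measurable_fun setT f -> (forall x, 0 <= f x) ->
  \int[m]_x f x = \int[mu]_x (f x * (q x)%:E).
Proof.
move=> mf f0; have mqE : measurable_fun setT (EFin \o q) by exact/measurable_EFinP.
pose h := nnsfun_approx measurableT mf.
have hf x : f x = lim ((EFin \o h n) x @[n --> \oo]).
  by apply/esym/cvg_lim => //; exact: cvg_nnsfun_approx.
transitivity (lim (\int[m]_x (h n x)%:E @[n --> \oo])).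
  rewrite -monotone_convergence//.
  - exact: eq_integral.
  - by move=> n; exact/measurable_EFinP.
  - by move=> n x _; rewrite lee_fin.
  - by move=> x _ a b ab; rewrite lee_fin; exact/lefP/nd_nnsfun_approx.
transitivity (lim (\int[mu]_x ((h n x)%:E * (q x)%:E) @[n --> \oo])).
  by apply: congr_lim; apply/funext => n; exact: integral_density_nnsfun.
rewrite -monotone_convergence//.
- apply: eq_integral => x _; apply/cvg_lim => //.
  by apply: cvgeZr => //; exact: cvg_nnsfun_approx.
- by move=> n; apply: emeasurable_funM => //; exact/measurable_EFinP.
- by move=> n x _; rewrite mule_ge0// lee_fin.
- move=> x _ a b ab; apply: lee_wpmul2r; rewrite lee_fin//.
  exact/lefP/nd_nnsfun_approx.
Qed.

End density.

Section affine.
Local Open Scope ereal_scope.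
Context {R : realType}.
Local Notation mu := (@lebesgue_measure R).

Let measurable_affine (a b : R) :
  measurable_fun [set: measurableTypeR R]
    ((fun t => a + b * t)%R : measurableTypeR R -> measurableTypeR R).
Proof.
by apply: measurable_funD => //; apply: measurable_funM.
Qed.

Lemma lebesgue_measure_affine (a b : R) (A : set R) : (b != 0)%R ->
  measurable A ->
  mu A = (`|b|)%:E * mu ((fun t => a + b * t)%R @^-1` A).
Proof.
move=> b0 mA.
pose f : measurableTypeR R -> measurableTypeR R := (fun t => a + b * t)%R.
pose nb : {nonneg R} := NngNum (normr_ge0 b).
have mf : measurable_fun setT f by exact: measurable_affine.
pose f' : {mfun _ >-> _} := HB.pack f (isMeasurableFun.Build _ _ _ _ _ mf).
rewrite [RHS](_ : _ = mscale nb (pushforward mu f') A)//.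
apply: lebesgue_measure_unique => //= _ [[u v]] _ <-.
rewrite /mscale/= /pushforward /=.
have [b_gt0|] := ltP 0%R b.
  rewrite (_ : f @^-1` _ = `]((u - a) / b)%R, ((v - a) / b)%R]%classic); last first.
    apply/seteqP; split => t /=; rewrite !in_itv/= ltr_pdivrMr// ler_pdivlMr//;
      by rewrite ltrBlDl lerBrDl mulrC.
  rewrite !lebesgue_measure_itv/= !lte_fin ltr_pM2r ?invr_gt0// ltrD2r.
  case: ifP => uv; last by rewrite mule0.
  by rewrite !EFinN -!EFinD -EFinM gtr0_norm//; congr EFin; field.
rewrite le_eqVlt (negbTE b0)/= => b_lt0.
rewrite (_ : f @^-1` _ = `[((v - a) / b)%R, ((u - a) / b)%R[%classic); last first.
  apply/seteqP; split => t /=; rewrite !in_itv/= ltr_ndivlMr// ler_ndivrMr//;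
    by rewrite ltrBlDl lerBrDl mulrC andbC.
rewrite !lebesgue_measure_itv/= !lte_fin ltr_nM2r ?invr_lt0// ltrD2r.
case: ifP => uv; last by rewrite mule0.
by rewrite !EFinN -!EFinD -EFinM ltr0_norm//; congr EFin; field.
Qed.

Lemma ge0_integral_affine (a b : R) (f : R -> \bar R) : (b != 0)%R ->
  measurable_fun setT f -> (forall x, 0 <= f x) ->
  \int[mu]_x f x = (`|b|)%:E * \int[mu]_t f (a + b * t)%R.
Proof.
move=> b0 mf f0.
pose g : measurableTypeR R -> measurableTypeR R := (fun t => a + b * t)%R.
have mg : measurable_fun setT g by exact: measurable_affine.
pose nb : {nonneg R} := NngNum (normr_ge0 b).
pose g' : {mfun _ >-> _} := HB.pack g (isMeasurableFun.Build _ _ _ _ _ mg).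
rewrite [LHS](eq_measure_integral (mscale nb (pushforward mu g'))); last first.
  by move=> A mA _; exact: lebesgue_measure_affine.
rewrite ge0_integral_mscale//; congr (_ * _).
rewrite ge0_integral_pushforward//.
Qed.

End affine.

Section triangle.
Local Open Scope ereal_scope.
Context {R : realType}.
Local Notation mu := (@lebesgue_measure R).

(** Read from right to left with the roles of [u] and [v] exchanged, this also
covers the inner integrals over [(x, b)]. *)
Lemma tonelli_triangle (a b : R) (u v : R -> \bar R) :
  measurable_fun setT u -> measurable_fun setT v ->
  (forall x, 0 <= u x) -> (forall x, 0 <= v x) ->
  \int[mu]_(x in `]a, b[) (u x * \int[mu]_(y in `]a, x[) v y) =
  \int[mu]_(y in `]a, b[) (v y * \int[mu]_(x in `]y, b[) u x).
Proof.
move=> mu_ mv u0 v0.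
pose M := measurableTypeR R.
pose S : set (M * M) := [set z | (a < z.2)%R && (z.2 < z.1)%R && (z.1 < b)%R].
have mS : measurable S.
  pose Sb (z : M * M) := (a < z.2)%R && (z.2 < z.1)%R && (z.1 < b)%R.
  have mSb : measurable_fun setT Sb.
    rewrite /Sb; apply: measurable_and; [apply: measurable_and|].
    - by apply: measurable_fun_ltr; [exact: measurable_cst|exact: measurable_snd].
    - by apply: measurable_fun_ltr; [exact: measurable_snd|exact: measurable_fst].
    - by apply: measurable_fun_ltr; [exact: measurable_fst|exact: measurable_cst].
  have -> : S = setT `&` Sb @^-1` [set true] by rewrite setTI.
  exact: mSb.
pose f (z : M * M) := (\1_S z)%:E * (u z.1 * v z.2).
have mf : measurable_fun setT f.
  apply: emeasurable_funM; first exact/measurable_EFinP/measurable_indic.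
  by apply: emeasurable_funM; exact: measurableT_comp.
have f0 z : 0 <= f z by rewrite !mule_ge0// lee_fin.
have mS2 (A : set R) (w : R -> \bar R) : measurable A -> measurable_fun setT w ->
    measurable_fun setT (fun y => (\1_A y)%:E * w y).
  move=> mA mw; apply: emeasurable_funM => //.
  exact/measurable_EFinP/measurable_indic.
have intE (A : set R) (c : \bar R) (w : R -> \bar R) : measurable A ->
    measurable_fun setT w -> (forall x, 0 <= w x) -> 0 <= c ->
    c * \int[mu]_(y in A) w y = \int[mu]_y (c * (w y * (\1_A y)%:E)).
  move=> mA mw w0 c0; rewrite integral_mkcond epatch_indic ge0_integralZl//.
    by apply: emeasurable_funM => //; exact/measurable_EFinP/measurable_indic.
  by move=> x _; rewrite mule_ge0// lee_fin.
have SE x y : \1_S (x, y) = ((a < y)%R && (y < x)%R && (x < b)%R)%:R%R :> R.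
  rewrite indicE; congr ((nat_of_bool _) %:R)%R.
  by apply/idP/idP; rewrite inE.
have IE c e y : \1_(`]c, e[%classic : set R) y = ((c < y)%R && (y < e)%R)%:R%R :> R.
  by rewrite indicE mem_setE in_itv.
transitivity (\int[mu]_x \int[mu]_y f (x, y)).
  rewrite integral_mkcond; apply: eq_integral => x _; rewrite patchE.
  case: ifPn => [|xab].
    rewrite inE/= in_itv/= => /andP[ax xb]; rewrite intE//.
    by apply: eq_integral => y _; rewrite /f/= SE IE xb andbT [RHS]muleC muleA.
  rewrite integral0_eq// => y _; rewrite /f SE.
  rewrite (_ : _ && _ = false) ?mul0e//; apply: contraNF xab.
  move=> /andP[/andP[ay yx] xb].
  by rewrite inE/= in_itv/= (lt_trans ay yx) xb.
rewrite fubini_tonelli//; apply/esym.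
rewrite integral_mkcond; apply: eq_integral => y _; rewrite patchE.
case: ifPn => [|yab].
  rewrite inE/= in_itv/= => /andP[ay yb]; rewrite intE//.
  apply: eq_integral => x _; rewrite /f/= SE IE ay/= [RHS]muleC.
  by rewrite [u x * v y]muleC muleA.
rewrite integral0_eq// => x _; rewrite /f SE.
rewrite (_ : _ && _ = false) ?mul0e//; apply: contraNF yab.
move=> /andP[/andP[ay yx] xb].
by rewrite inE/= in_itv/= ay (lt_trans yx xb).
Qed.

End triangle.

Section section_integral.
Local Open Scope ereal_scope.
Context {R : realType}.
Local Notation mu := (@lebesgue_measure R).
Local Notation M := (measurableTypeR R).
Variables (v : M -> \bar R).
Hypotheses (mv : measurable_fun setT v) (v0 : forall y, 0 <= v y).

Let measurable_integral_section (b : M * M -> bool) : measurable_fun setT b ->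
  measurable_fun [set: M] (fun x => \int[mu]_(y in [set y | b (x, y)]) v y).
Proof.
move=> mb.
pose f (z : M * M) := if b z then v z.2 else 0.
have mf : measurable_fun setT f.
  apply: measurable_fun_ifT => //; exact: (measurableT_comp mv measurable_snd).
have f0 z : 0 <= f z by rewrite /f; case: ifP.
have mG : measurable_fun setT (fubini_F mu f).
  exact: (measurable_fun_fubini_tonelli_F (m2 := mu) f mf f0).
suff -> : (fun x => \int[mu]_(y in [set y | b (x, y)]) v y) = fubini_F mu f by [].
apply/funext => x; rewrite integral_mkcond /fubini_F; apply: eq_integral => y _.
by rewrite patchE /f; congr (if _ then _ else _); apply/idP/idP; rewrite inE.
Qed.

Let measurable_ltr_prod (f g : M * M -> M) : measurable_fun setT f ->
  measurable_fun setT g -> measurable_fun setT (fun z => (f z < g z)%R).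
Proof. exact: measurable_fun_ltr. Qed.

Lemma measurable_integral_itv_left (a : R) :
  measurable_fun [set: M] (fun x => \int[mu]_(y in `]a, x[) v y).
Proof.
have := @measurable_integral_section (fun z => (a < z.2)%R && (z.2 < z.1)%R).
rewrite (_ : (fun x => _) = (fun x => \int[mu]_(y in `]a, x[) v y)).
  apply; apply: measurable_and; apply: measurable_ltr_prod;
    [exact: measurable_cst|exact: measurable_snd|exact: measurable_snd|exact: measurable_fst].
by apply/funext => x; congr (integral mu _ v); apply/seteqP; split => y /=; rewrite in_itv.
Qed.

Lemma measurable_integral_itv_right (b : R) :
  measurable_fun [set: M] (fun x => \int[mu]_(y in `]x, b[) v y).
Proof.
have := @measurable_integral_section (fun z => (z.1 < z.2)%R && (z.2 < b)%R).
rewrite (_ : (fun x => _) = (fun x => \int[mu]_(y in `]x, b[) v y)).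
  apply; apply: measurable_and; apply: measurable_ltr_prod;
    [exact: measurable_fst|exact: measurable_snd|exact: measurable_snd|exact: measurable_cst].
by apply/funext => x; congr (integral mu _ v); apply/seteqP; split => y /=; rewrite in_itv.
Qed.

End section_integral.

(** * Doeblin's contraction for iterated random maps *)

Section doeblin.
Local Open Scope ereal_scope.
Context d (T : measurableType d) d' (V : measurableType d') (R : realType).
Variables (nu : probability V R) (g : T * V -> T).
Hypothesis mg : measurable_fun setT g.
Variable D : set T.
Hypothesis mD : measurable D.
Hypothesis gD : forall x, D x -> {ae nu, forall v, D (g (x, v))}.

(** The transition operator of the chain that moves from [x] to [g (x, v)] for a
random [v] of law [nu]. *)
Definition random_map_op (f : T -> \bar R) (x : T) := \int[nu]_v f (g (x, v)).
Local Notation K := random_map_op.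

Let mgx x : measurable_fun setT (fun v => g (x, v)).
Proof. exact: measurableT_comp. Qed.

Lemma random_map_op_ge0 f : (forall x, 0 <= f x) -> forall x, 0 <= K f x.
Proof. by move=> f0 x; exact: integral_ge0. Qed.

Lemma measurable_random_map_op f : measurable_fun setT f ->
  (forall x, 0 <= f x) -> measurable_fun setT (K f).
Proof.
move=> mf f0.
apply: (measurable_fun_fubini_tonelli_F (m2 := nu) (f \o g)).
  exact: measurableT_comp.
by move=> x; exact: f0.
Qed.

(** [D] is almost surely absorbing, so only the values on [D] matter there.  This
lets functions that are only bounded on [D] be cut off outside it. *)
Lemma eq_random_map_op f1 f2 :
  measurable_fun setT f1 -> measurable_fun setT f2 ->
  (forall x, 0 <= f1 x) -> (forall x, 0 <= f2 x) ->
  (forall x, D x -> f1 x = f2 x) -> forall x, D x -> K f1 x = K f2 x.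
Proof.
move=> mf1 mf2 f10 f20 f12 x Dx; apply: ge0_ae_eq_integral => //.
- exact: measurableT_comp.
- exact: measurableT_comp.
- by apply: filterS (gD Dx) => v Dv _; exact: f12.
Qed.

Lemma random_map_opD f1 f2 :
  measurable_fun setT f1 -> measurable_fun setT f2 ->
  (forall x, 0 <= f1 x) -> (forall x, 0 <= f2 x) ->
  forall x, K (f1 \+ f2) x = K f1 x + K f2 x.
Proof.
move=> mf1 mf2 f10 f20 x; rewrite /K ge0_integralD//.
- exact: measurableT_comp.
- exact: measurableT_comp.
Qed.

Lemma random_map_op_cst (c : R) x : K (cst c%:E) x = c%:E.
Proof. rewrite /random_map_op integral_cst//=. by rewrite probability_setT mule1. Qed.

Lemma random_map_op_indic A x : measurable A ->
  K (EFin \o \1_A) x = nu [set v | A (g (x, v))].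
Proof.
move=> mA; have mpre : measurable ((fun v => g (x, v)) @^-1` A).
  by rewrite -[X in measurable X]setTI; exact: mgx.
rewrite -[RHS](_ : \int[nu]_v (\1_((fun v => g (x, v)) @^-1` A) v)%:E = _)//.
by rewrite integral_indic// setIT.
Qed.

(** A one-step evolution known on events extends to integrands, because [m'] is
the image under [g] of the product of [m] and [nu]. *)
Lemma random_map_op_integral (m m' : probability T R) f :
  (forall A, measurable A -> m' A = \int[m]_x nu [set v | A (g (x, v))]) ->
  measurable_fun setT f -> (forall x, 0 <= f x) ->
  \int[m']_x f x = \int[m]_x K f x.
Proof.
move=> m'E mf f0.
pose g' : {mfun _ >-> _} := HB.pack g (isMeasurableFun.Build _ _ _ _ _ mg).
rewrite (eq_measure_integral (pushforward (m \x nu) g')); last first.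
  move=> A mA _ /=; rewrite m'E//; apply: eq_integral => x _ /=.
  by congr (nu _); apply/seteqP; split => v /=; rewrite /xsection/= inE.
rewrite ge0_integral_pushforward// preimage_setT fubini_tonelli1//.
- exact: measurableT_comp.
- by move=> x; exact: f0.
Qed.

Variables (rho : {measure set T -> \bar R}) (B : set T).
Hypotheses (mB : measurable B) (BD : B `<=` D).
Hypothesis minorization : forall f, measurable_fun setT f ->
  (forall x, 0 <= f x) ->
  forall x, D x -> \int[rho]_(y in B) f y <= K (K f) x.


Local Notation alpha := (fine (rho B)).

Lemma minorizing_mass_le1 x : D x -> rho B <= 1.
Proof.
move=> Dx; have := minorization (measurable_cst 1) (fun _ => lee01) Dx.
rewrite integral_cst// mul1e => /le_trans; apply.
have -> : K (cst 1) = cst 1 by apply/funext => y; exact: random_map_op_cst.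
by rewrite random_map_op_cst.
Qed.

Let rhoD_fin x : D x -> rho B \is a fin_num.
Proof.
by move=> /minorizing_mass_le1 rD; rewrite ge0_fin_numE// (le_lt_trans rD) ?ltry.
Qed.

(** Write [f = a + f1 = b - f2] on [D].  The minorization applied to [f1] raises
the lower bound [a] by the integral of [f1] over [B], and applied to [f2] it
lowers the upper bound [b] by that of [f2]; together these gains amount to
[alpha * (b - a)]. *)
Lemma doeblin_contraction f (a b : R) : measurable_fun setT f ->
  (forall x, 0 <= f x) -> (0 <= a)%R -> (a <= b)%R ->
  (forall x, D x -> a%:E <= f x <= b%:E) ->
  exists a' b', [/\ (0 <= a')%R, (a' <= b')%R, (b' - a' <= (1 - alpha) * (b - a))%R &
    forall x, D x -> a'%:E <= K (K f) x <= b'%:E].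
Proof.
move=> mf f0 a0 ab fab.
have [D0|/set0P[x0 Dx0]] := eqVneq D set0.
  exists 0%R, 0%R; split => //; last by move=> x; rewrite D0.
  have -> : alpha = 0%R by rewrite (_ : B = set0) ?measure0// -subset0 -D0.
  by rewrite subrr subr0 mul1r subr_ge0.
pose f1 := (fun x => f x - a%:E) \_ D.
pose f2 := (fun x => b%:E - f x) \_ D.
have ffin x : D x -> f x \is a fin_num.
  move=> /fab/andP[af fb]; rewrite fin_numElt (lt_le_trans _ af) ?ltNyr//=.
  by rewrite (le_lt_trans fb) ?ltry.
have mf1 : measurable_fun setT f1.
  by apply/(measurable_restrictT _ mD)/measurable_funTS/emeasurable_funB.
have mf2 : measurable_fun setT f2.
  by apply/(measurable_restrictT _ mD)/measurable_funTS/emeasurable_funB.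
have f10 x : 0 <= f1 x.
  by apply: erestrict_ge0 => {}x /fab/andP[af _]; rewrite sube_ge0.
have f20 x : 0 <= f2 x.
  by apply: erestrict_ge0 => {}x Dx; rewrite sube_ge0 ?ffin//; case/andP: (fab _ Dx).
have KKE g1 g2 c : measurable_fun setT g1 -> measurable_fun setT g2 ->
    (forall x, 0 <= g1 x) -> (forall x, 0 <= g2 x) ->
    (forall x, D x -> g1 x + g2 x = c%:E) ->
    (0 <= c)%R ->
    forall x, D x -> K (K g1) x + K (K g2) x = c%:E.
  move=> mg1 mg2 g10 g20 g12 c0 x Dx.
  have K12 y : D y -> K g1 y + K g2 y = c%:E.
    move=> Dy; rewrite -random_map_opD// -(random_map_op_cst c y).
    apply: eq_random_map_op => //.
    - exact: emeasurable_funD.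
    - by move=> z; rewrite adde_ge0.
  rewrite -random_map_opD; first last.
  - exact: random_map_op_ge0.
  - exact: random_map_op_ge0.
  - exact: measurable_random_map_op.
  - exact: measurable_random_map_op.
  rewrite -(random_map_op_cst c x); apply: eq_random_map_op => //.
  - by apply: emeasurable_funD; exact: measurable_random_map_op.
  - by move=> y; rewrite adde_ge0// random_map_op_ge0.
set J1 := \int[rho]_(x in B) f1 x.
set J2 := \int[rho]_(x in B) f2 x.
have J12 : J1 + J2 = ((b - a) * alpha)%:E.
  rewrite -ge0_integralD//; last 2 first.
  - exact: measurable_funTS.
  - exact: measurable_funTS.
  rewrite (eq_integral (cst (b - a)%:E)); last first.
    move=> x /set_mem/BD xD; rewrite /f1 /f2 !patchE (mem_set xD).
    move: (ffin x xD) => /fineK <-.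
    by rewrite -!EFinB -EFinD; congr EFin; ring.
  by rewrite integral_cst// EFinM fineK ?(rhoD_fin Dx0).
have J1_ge0 : 0 <= J1 by exact: integral_ge0.
have J2_ge0 : 0 <= J2 by exact: integral_ge0.
have J1fin : J1 \is a fin_num.
  rewrite ge0_fin_numE// (@le_lt_trans _ _ (J1 + J2)) ?leeDl// J12 ltry//.
have J2fin : J2 \is a fin_num.
  rewrite ge0_fin_numE// (@le_lt_trans _ _ (J1 + J2)) ?leeDr// J12 ltry//.
have KKlow x : D x -> a%:E + J1 <= K (K f) x.
  move=> Dx.
  (* on [D] the function [f] is [f1] shifted by [a], and [K] commutes with shifts *)
  have f1a y : D y -> f y = (f1 \+ cst a%:E) y.
    by move=> Dy; rewrite /f1/= patchE mem_set//= EFinN subeK.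
  have K1a y : D y -> K f y = (K f1 \+ cst a%:E) y.
    move=> Dy; rewrite /= -(random_map_op_cst a y) -random_map_opD//.
    apply: eq_random_map_op => //; first exact: emeasurable_funD.
    by move=> z; rewrite adde_ge0// lee_fin.
  rewrite (@eq_random_map_op _ (K f1 \+ cst a%:E))//.
  - rewrite random_map_opD//; last 2 first.
    + exact: measurable_random_map_op.
    + exact: random_map_op_ge0.
    by rewrite random_map_op_cst addeC leeD// minorization.
  - exact: measurable_random_map_op.
  - by apply: emeasurable_funD => //; exact: measurable_random_map_op.
  - exact: random_map_op_ge0.
  - by move=> z; rewrite adde_ge0// ?random_map_op_ge0// lee_fin.
have KKupp x : D x -> K (K f) x <= b%:E - J2.
  move=> Dx; rewrite leeBrDr//.
  have <- : K (K f) x + K (K f2) x = b%:E.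
    apply: KKE => //; last exact: le_trans ab.
    by move=> y Dy; rewrite /f2/= patchE mem_set//= addeC subeK ?ffin.
  by rewrite leeD2l// minorization.
exists (a + fine J1)%R, (b - fine J2)%R.
have J12r : (fine J1 + fine J2 = (b - a) * alpha)%R.
  by rewrite -fineD// J12.
split.
- by rewrite addr_ge0// fine_ge0.
- rewrite -lee_fin EFinB EFinD !fineK//.
  by rewrite (le_trans (KKlow x0 Dx0))// KKupp.
- rewrite (_ : _ - _ = b - a - (fine J1 + fine J2))%R; last by ring.
  by rewrite J12r (_ : (1 - alpha) * (b - a) = b - a - (b - a) * alpha)%R//; ring.
- by move=> x Dx; rewrite EFinB EFinD !fineK// KKlow//= KKupp.
Qed.


(** The laws [m n] are those of a chain moved by [g], in terms of events only. *)
Definition evolves (m : nat -> probability T R) := forall n A, measurable A ->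
  m n.+1 A = \int[m n]_x nu [set v | A (g (x, v))].

Lemma integral_probability_full (P : probability T R) f : P D = 1 -> measurable_fun setT f ->
  (forall x, 0 <= f x) -> \int[P]_x f x = \int[P]_(x in D) f x.
Proof.
move=> PD mf f0; rewrite (@ge0_negligible_integral _ _ _ _ setT (~` D))//.
- by rewrite setTD setCK.
- exact: measurableC.
- by transitivity (1 - P D); [exact: probability_setC|rewrite PD subee].
Qed.

Let evolvesD m : evolves m -> m 0%N D = 1 -> forall n, m n D = 1.
Proof.
move=> em m0D; elim=> // n mnD; pose f : T -> \bar R := EFin \o \1_D.
have mf : measurable_fun setT f by exact/measurable_EFinP/measurable_indic.
have f0 x : 0 <= f x by rewrite lee_fin.
rewrite -[D in LHS]setIT -integral_indic// (random_map_op_integral (em n) mf)//.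
rewrite integral_probability_full//; last 2 first.
- exact: measurable_random_map_op.
- exact: random_map_op_ge0.
rewrite (eq_integral (cst 1)) ?integral_cst ?mul1e// => x /set_mem Dx.
rewrite -(random_map_op_cst 1 x); apply: eq_random_map_op => // y Dy.
by rewrite /f/= indicE mem_set.
Qed.

Let KK f := K (K f).

Let iterKK n f : measurable_fun setT f -> (forall x, 0 <= f x) ->
  measurable_fun setT (iter n KK f) /\ forall x, 0 <= iter n KK f x.
Proof.
move=> mf f0; elim: n => //= n [mi i0]; split.
  apply: measurable_random_map_op; last exact: random_map_op_ge0.
  exact: measurable_random_map_op.
exact/random_map_op_ge0/random_map_op_ge0.
Qed.

Let evolves_iter m n f k : evolves m -> measurable_fun setT f ->
  (forall x, 0 <= f x) ->
  \int[m (k + n.*2)%N]_x f x = \int[m k]_x iter n KK f x.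
Proof.
move=> em mf f0; elim: n k => [|n IHn] k; first by rewrite addn0.
have [mg' g'0] := iterKK n mf f0.
rewrite doubleS !addnS -!addSn IHn iterS.
rewrite (random_map_op_integral (em _))// (random_map_op_integral (em _))//.
- exact: measurable_random_map_op.
- exact: random_map_op_ge0.
Qed.

(** The mass of [A] after [2 n] steps is the integral, under the initial law, of
the [2 n]-fold image of its indicator, a function whose oscillation on [D] has
been contracted [n] times. *)
Lemma doeblin_evolves_even m m' : evolves m -> evolves m' ->
  m 0%N D = 1 -> m' 0%N D = 1 -> forall n A, measurable A ->
  `|m n.*2 A - m' n.*2 A| <= ((1 - alpha) ^+ n)%:E.
Proof.
move=> em em' mD1 m'D1 n A mA.
pose f : T -> \bar R := EFin \o \1_A.
have mf : measurable_fun setT f by exact/measurable_EFinP/measurable_indic.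
have f0 x : 0 <= f x by rewrite lee_fin.
have [a [b [a0 ab gap fab]]] : exists a b, [/\ (0 <= a)%R, (a <= b)%R,
    (b - a <= (1 - alpha) ^+ n)%R &
    forall x, D x -> a%:E <= iter n KK f x <= b%:E].
  elim: n => [|n [a [b [a0 ab gap fab]]]].
    exists 0%R, 1%R; rewrite subr0 expr0; split => // x _ /=.
    by rewrite /f/= !lee_fin indicE; case: (_ \in _) => /=; rewrite lexx ler01.
  have [mi i0] := iterKK n mf f0.
  have [a' [b' [a'0 ab' gap' fab']]] := doeblin_contraction mi i0 a0 ab fab.
  exists a', b'; split => //; rewrite (le_trans gap')// exprS ler_wpM2l//.
  have [D0|/set0P[x0 Dx0]] := eqVneq D set0.
    by rewrite (_ : B = set0) ?measure0 ?subr0// -subset0 -D0.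
  by rewrite subr_ge0 -lee_fin fineK ?(rhoD_fin Dx0)// (minorizing_mass_le1 Dx0).
have bnd (P : nat -> probability T R) : evolves P -> P 0%N D = 1 ->
    a%:E <= P n.*2 A <= b%:E.
  move=> eP PD; have [mi i0] := iterKK n mf f0.
  have PE : P n.*2 A = \int[P 0%N]_(x in D) iter n KK f x.
    rewrite -integral_probability_full//; transitivity (\int[P (0 + n.*2)%N]_x f x).
      by rewrite -[A in LHS]setIT -integral_indic.
    exact: evolves_iter.
  rewrite PE; apply/andP; split.
    have -> : a%:E = \int[P 0%N]_(x in D) (cst a%:E) x.
      by rewrite integral_cst// [X in _ * X]PD mule1.
    apply: ge0_le_integral => //.
    - exact: measurable_funTS.
    - by move=> x /fab/andP[].
  have -> : b%:E = \int[P 0%N]_(x in D) (cst b%:E) x.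
    by rewrite integral_cst// [X in _ * X]PD mule1.
  apply: ge0_le_integral => //.
  - exact: measurable_funTS.
  - by move=> x /fab/andP[].
have /andP[] := bnd m em mD1; have /andP[] := bnd m' em' m'D1.
have : m n.*2 A \is a fin_num by exact: fin_num_measure.
have : m' n.*2 A \is a fin_num by exact: fin_num_measure.
move=> /fineK <- /fineK <-; rewrite -EFinB abse_EFin !lee_fin => a1 b1 a2 b2.
rewrite (le_trans _ gap)// ler_norml; lra.
Qed.

(** For odd times, discard the first step. *)
Lemma doeblin_evolves m m' : evolves m -> evolves m' ->
  m 0%N D = 1 -> m' 0%N D = 1 -> forall n A, measurable A ->
  `|m n A - m' n A| <= ((1 - alpha) ^+ n./2)%:E.
Proof.
move=> em em' mD1 m'D1 n A mA; rewrite -{1 2}(odd_double_half n).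
pose s (m : nat -> probability T R) k := m (odd n + k)%N.
apply: (@doeblin_evolves_even (s m) (s m')) => //.
- by move=> k A' mA'; rewrite /s addnS em.
- by move=> k A' mA'; rewrite /s addnS em'.
- by rewrite /s addn0 evolvesD.
- by rewrite /s addn0 evolvesD.
Qed.

End doeblin.

(** * Integrating a bounded function against the exponential of its primitive *)

Section exp_primitive.
Context {R : realType}.
Local Notation mu := (@lebesgue_measure R).
Implicit Types (c d x y M : R) (s psi f : R -> R).

(** Bisecting [n] times improves the quadratic bound by a factor [2 ^ n]. *)
Lemma additive_quadratic_eq0 (Delta : R -> R -> R) c d M :
  (forall x y z, c <= x -> x <= y -> y <= z -> z <= d ->
     Delta x z = Delta x y + Delta y z) ->
  (forall x y, c <= x -> x <= y -> y <= d ->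
     `|Delta x y| <= M * (y - x) ^+ 2) ->
  forall x y, c <= x -> x <= y -> y <= d -> Delta x y = 0.
Proof.
move=> addD quadD x y cx xy yd.
have small n : forall x y, c <= x -> x <= y -> y <= d ->
    `|Delta x y| <= M * (y - x) ^+ 2 / 2 ^+ n.
  elim: n => [|n IHn] {cx xy yd}x {}y cx xy yd; first by rewrite expr0 divr1 quadD.
  have [xm my] := midf_le xy; set m := (x + y) / 2 in xm my.
  rewrite (addD x m y)// (le_trans (ler_normD _ _))//.
  rewrite (le_trans (lerD (IHn x m cx xm (le_trans my yd))
                          (IHn m y (le_trans cx xm) my yd)))//.
  rewrite le_eqVlt; apply/orP; left; apply/eqP.
  have : (2 : R) ^+ n != 0 by rewrite expf_neq0.
  by rewrite [2 ^+ n.+1]exprS /m; move: (2 ^+ n) => k k0; field.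
apply/eqP; rewrite -normr_eq0 eq_le normr_ge0 andbT leNgt; apply/negP => D0.
set K := M * (y - x) ^+ 2 in small.
have K0 : 0 <= K by have := small 0%N x y cx xy yd; rewrite expr0 divr1; exact: le_trans.
pose n := (Num.truncn (K / `|Delta x y|)).+1.
have : K / `|Delta x y| < 2 ^+ n.
  rewrite (lt_trans (truncnS_gt _))//.
  by rewrite -natrX ltr_nat ltn_expl.
rewrite ltr_pdivrMr// mulrC -ltr_pdivrMr ?exprn_gt0//.
by rewrite ltNge small.
Qed.

Lemma bounded_itv_integrable c d M f : measurable_fun `[c, d] f ->
  (forall x, c <= x <= d -> `|f x| <= M) -> mu.-integrable `[c, d] (EFin \o f).
Proof.
move=> mf fM; apply: measurable_bounded_integrable => //.
  by rewrite /= lebesgue_measure_itv/=; case: ifP => // _; rewrite -EFinB ltry.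
exists M; split; first exact: num_real.
move=> K MK x /=; rewrite in_itv/= => xcd.
by rewrite (le_trans (fM x xcd))// ltW.
Qed.

Lemma nondecreasing_itv_measurable (i : interval R) f :
  (forall x y, x \in i -> y \in i -> x <= y -> f x <= f y) ->
  measurable_fun [set` i] f.
Proof.
move=> f_nd mi; apply: (measurability (@RGenCInfty.G R)) => //.
  exact: RGenCInfty.measurableE.
move=> /= _ [_ [a ->]] <-.
apply: is_interval_measurable => x y [xi ax] [yi _] z xzy.
have zi : z \in i by exact: (interval_is_interval xi yi xzy).
split => //; move: ax; rewrite /= !in_itv/= !andbT => /le_trans; apply.
by apply: f_nd => //; case/andP: xzy.
Qed.

Lemma Rintegral_itv_split c d f x y z : mu.-integrable `[c, d] (EFin \o f) ->
  c <= x -> x <= y -> y <= z -> z <= d ->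
  \int[mu]_(t in `[x, z]) f t =
  \int[mu]_(t in `[x, y]) f t + \int[mu]_(t in `[y, z]) f t.
Proof.
move=> intf cx xy yz zd.
have sub u v : c <= u -> v <= d -> mu.-integrable `[u, v] (EFin \o f).
  move=> cu vd; apply: integrableS intf => //.
  by apply: subset_itv; rewrite bnd_simp.
apply/eqP; rewrite addrC -subr_eq Rintegral_itvB ?bnd_simp//; last exact: sub.
rewrite Rintegral_itv_obnd_cbnd//; apply: integrableS (sub y z _ zd) => //.
  exact: (subset_itvr (lexx _ : (BLeft y <= BRight y)%O)).
by rewrite (le_trans cx).
Qed.

Lemma normr_Rintegral_le c d M f : mu.-integrable `[c, d] (EFin \o f) ->
  (forall x, c <= x <= d -> `|f x| <= M) -> c <= d ->
  `|\int[mu]_(t in `[c, d]) f t| <= M * (d - c).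
Proof.
move=> intf fM cd; rewrite (le_trans (le_normr_Rintegral _ intf))//.
have -> : M * (d - c) = \int[mu]_(t in `[c, d]) M.
  rewrite Rintegral_cst//= lebesgue_measure_itv/= lte_fin.
  by case: ltgtP cd => //= -> _; rewrite subrr.
apply: le_Rintegral => //.
- by apply: integrable_norm.
- apply: (bounded_itv_integrable (M := `|M|)) => // x _.
Qed.


Let expR_chord_lower (u v : R) : expR u * (v - u) <= expR v - expR u.
Proof.
rewrite lerBrDr -{2}(subrK u v) expRD [leRHS]mulrC -[X in _ + X]mulr1 -mulrDr.
rewrite ler_pM2l ?expR_gt0//.
by rewrite addrC expR_ge1Dx.
Qed.

Let expR_lip (T u v : R) : u <= T -> v <= T ->
  `|expR v - expR u| <= expR T * `|v - u|.
Proof.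
wlog uv : u v / u <= v.
  move=> h uT vT; have [uv|/ltW vu] := leP u v; first exact: h.
  by rewrite distrC [`|v - u|]distrC h.
move=> uT vT; rewrite !ger0_norm ?subr_ge0 ?ler_expR//.
have := expR_chord_lower v u; rewrite -[u - v]opprB mulrN -[expR u - _]opprB lerN2.
by move=> /le_trans; apply; rewrite ler_wpM2r ?subr_ge0// ler_expR.
Qed.

Let expR_taylor (T u v : R) : u <= T -> v <= T ->
  `|expR v - expR u - expR u * (v - u)| <= expR T * (v - u) ^+ 2.
Proof.
move=> uT vT; rewrite ger0_norm ?subr_ge0//.
have up : expR v - expR u <= expR v * (v - u).
  by rewrite -lerN2 opprB -mulrN opprB.
apply: (@le_trans _ _ ((expR v - expR u) * (v - u))).
  by rewrite mulrBl lerB.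
rewrite expr2 mulrA -[leLHS]ger0_norm; last first.
  have [uv|/ltW vu] := leP u v.
    by rewrite mulr_ge0// subr_ge0// ler_expR.
  by rewrite mulr_le0// subr_le0// ler_expR.
rewrite normrM (le_trans (ler_wpM2r (normr_ge0 _) (expR_lip uT vT)))//.
by rewrite -!mulrA -normrM ger0_norm// -expr2 sqr_ge0.
Qed.

(** On a short interval both sides equal [expR (psi x) * (psi y - psi x)] up to a
term quadratic in the length, so their difference, which is additive, is zero.
No regularity of [s] beyond boundedness enters, whence the identity holds even
where [psi] has no derivative. *)
Lemma integral_mul_expR c d M s psi : c <= d ->
  measurable_fun `[c, d] s -> (forall x, c <= x <= d -> `|s x| <= M) ->
  (forall x y, c <= x -> x <= y -> y <= d ->
     psi y - psi x = \int[mu]_(t in `[x, y]) s t) ->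
  (\int[mu]_(t in `[c, d]) (s t * expR (psi t))%:E =
   (expR (psi d) - expR (psi c))%:E)%E.
Proof.
move=> cd ms sM psiE.
have M0 : 0 <= M by rewrite (le_trans _ (sM c _)) ?lexx.
have subM f x y : measurable_fun `[c, d] f -> c <= x -> y <= d ->
    measurable_fun `[x, y] f.
  move=> mf cx yd; apply: measurable_funS mf => //.
  by apply: subset_itv; rewrite bnd_simp.
have lip x y : c <= x -> x <= y -> y <= d -> `|psi y - psi x| <= M * (y - x).
  move=> cx xy yd; rewrite psiE//; apply: normr_Rintegral_le => //; last first.
    by move=> t /andP[xt ty]; rewrite sM// (le_trans cx)//= (le_trans ty).
  apply: (@bounded_itv_integrable _ _ M); first exact: subM.
  by move=> t /andP[xt ty]; rewrite sM// (le_trans cx)//= (le_trans ty).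
have mpsi : measurable_fun `[c, d] psi.
  (* [psi] is [M]-Lipschitz, so adding [M * t] makes it nondecreasing *)
  have mg : measurable_fun `[c, d] (fun t => psi t + M * t).
    apply: nondecreasing_itv_measurable => t u.
    rewrite !in_itv/= => /andP[ct _] /andP[_ ud] tu.
    have := lip _ _ ct tu ud.
    by rewrite ler_norml => /andP[+ _]; rewrite mulrBr; lra.
  have : measurable_fun `[c, d] (fun t => psi t + M * t - M * t).
    by apply: measurable_funB => //; exact: measurable_funM.
  by apply: eq_measurable_fun => t _; rewrite addrK.
pose T := psi c + M * (d - c).
have psiT x : c <= x -> x <= d -> psi x <= T.
  move=> cx xd; have := lip c x (lexx _) cx xd.
  rewrite ler_norml => /andP[_]; rewrite lerBlDl => /le_trans; apply.
  by rewrite lerD2l ler_wpM2l// lerD2r.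
pose g t := s t * expR (psi t).
have mg : measurable_fun `[c, d] g.
  by apply: measurable_funM => //; exact: measurableT_comp.
have intg : mu.-integrable `[c, d] (EFin \o g).
  apply: (@bounded_itv_integrable _ _ (M * expR T)) => // x /andP[cx xd].
  rewrite normrM ler_pM ?sM ?cx// ger0_norm ?expR_ge0// ler_expR.
  exact: psiT.
have ints : mu.-integrable `[c, d] (EFin \o s) by exact: bounded_itv_integrable ms sM.
pose Delta x y := \int[mu]_(t in `[x, y]) g t - (expR (psi y) - expR (psi x)).
suff : Delta c d = 0.
  move/eqP; rewrite subr_eq0 => /eqP <-; rewrite fineK//.
  exact: integrable_fin_num intg.
apply: (@additive_quadratic_eq0 _ c d (2 * (M ^+ 2 * expR T))) => //.
  move=> x y z cx xy yz zd; rewrite /Delta (Rintegral_itv_split intg cx xy yz zd).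
  by ring.
move=> x y cx xy yd.
have cxyd t : x <= t <= y -> c <= t <= d.
  by move=> /andP[xt ty]; rewrite (le_trans cx)//= (le_trans ty).
have cT t : c <= t <= d -> psi t <= T by move=> /andP[]; exact: psiT.
have xT : psi x <= T by rewrite cT// cxyd// lexx.
have yT : psi y <= T by rewrite cT// cxyd// lexx andbT.
have intS f : mu.-integrable `[c, d] (EFin \o f) -> mu.-integrable `[x, y] (EFin \o f).
  by move=> intf; apply: integrableS intf => //; apply: subset_itv; rewrite bnd_simp.
have intZ k f : mu.-integrable `[x, y] (EFin \o f) ->
    mu.-integrable `[x, y] (EFin \o (fun t => k * f t)).
  by move=> intf; rewrite (_ : _ \o _ = fun t => (k%:E * (EFin \o f) t)%E)//; exact: integrableZl.
have D1 : \int[mu]_(t in `[x, y]) g t - expR (psi x) * (psi y - psi x) =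
    \int[mu]_(t in `[x, y]) (s t * (expR (psi t) - expR (psi x))).
  rewrite psiE// -RintegralZl//; last exact: intS.
  rewrite -RintegralB//; last 2 first.
  - exact: intS.
  - by apply: intZ; exact: intS.
  by apply: eq_Rintegral => t _; rewrite /g mulrBr [expR (psi x) * _]mulrC.
have B1 : `|\int[mu]_(t in `[x, y]) (s t * (expR (psi t) - expR (psi x)))| <=
    M * (expR T * (M * (y - x))) * (y - x).
  apply: normr_Rintegral_le => //.
    rewrite (_ : _ \o _ = (fun t => (g t)%:E - (expR (psi x) * s t)%:E)%E); last first.
      by apply/funext => t; rewrite -EFinB /g; congr EFin; ring.
    apply: integrableB => //; first exact: intS.
    by apply: intZ; exact: intS.
  move=> t xty; rewrite normrM ler_pM ?sM ?cxyd//.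
  rewrite (le_trans (expR_lip xT (cT _ (cxyd _ xty))))// ler_wpM2l ?expR_ge0//.
  move/andP: (xty) => [xt ty].
  rewrite (le_trans (lip _ _ cx xt (le_trans ty yd)))// ler_wpM2l//.
  by rewrite lerD2r.
have B2 := expR_taylor xT yT.
have B3 : expR T * (psi y - psi x) ^+ 2 <= expR T * (M * (y - x)) ^+ 2.
  rewrite ler_wpM2l ?expR_ge0// -real_normK ?num_real//.
  by rewrite lerXn2r ?nnegrE// ?(lip _ _ cx)// mulr_ge0// subr_ge0.
rewrite (_ : Delta x y = (\int[mu]_(t in `[x, y]) g t - expR (psi x) * (psi y - psi x))
  - (expR (psi y) - expR (psi x) - expR (psi x) * (psi y - psi x))); last first.
  by rewrite /Delta; ring.
rewrite D1 (le_trans (ler_normB _ _))// (le_trans (lerD B1 (le_trans B2 B3)))//.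
by rewrite le_eqVlt; apply/orP; left; apply/eqP; ring.
Qed.

End exp_primitive.

(** * Improper and oriented integrals *)

Section improper.
Context {R : realType}.
Local Notation mu := (@lebesgue_measure R).
Implicit Types (c d x y L : R) (f F : R -> R).

(** Monotone convergence along an exhaustion of [D]. *)
Let ge0_integral_exhaust (S : (set R)^nat) D f (v : R^nat) L :
  nondecreasing_seq S -> (forall n, measurable (S n)) -> \bigcup_n S n = D ->
  measurable_fun D f -> (forall x, D x -> 0 <= f x) ->
  (forall n, (\int[mu]_(x in S n) (f x)%:E = (v n)%:E)%E) ->
  v n @[n --> \oo] --> L -> (\int[mu]_(x in D) (f x)%:E = L%:E)%E.
Proof.
move=> ndS mS UE mf f0 fv vL.
have sub n : S n `<=` D by rewrite -UE; exact: bigcup_sup.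
have := @ge0_nondecreasing_set_cvg_integral _ (measurableTypeR R) R S
  (EFin \o f) mu ndS mS _ _.
rewrite UE => /(_ _ _)/cvg_lim <- //.
- have -> : (fun n => \int[mu]_(x in S n) (EFin \o f) x)%E = EFin \o v.
    by apply/funext => n; rewrite /= fv.
  by apply/cvg_lim => //; apply: cvg_EFin => //; exact: nearW.
- move=> n; apply/measurable_EFinP; apply: measurable_funS mf => //.
  by rewrite -UE; exact: bigcup_measurable.
- by move=> n x /sub Dx; rewrite lee_fin; exact: f0.
Qed.

Let cvg_gap (e : R) : e / n.+2%:R @[n --> \oo] --> 0.
Proof.
rewrite -[X in _ --> X](mulr0 e); apply: cvgM; first exact: cvg_cst.
by have := @cvg_harmonic R; rewrite -cvg_shiftS; exact.
Qed.

Let gap_lt (e : R) n : 0 < e -> 0 < e / n.+2%:R < e.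
Proof.
by move=> e0; rewrite divr_gt0//= ltr_pdivrMr// ltr_pMr// ltr1n.
Qed.

Let gap_le (e : R) n : 0 < e -> e / n.+3%:R <= e / n.+2%:R.
Proof. by move=> e0; rewrite ler_pM2l// lef_pV2 ?posrE// ler_nat. Qed.

Lemma ge0_integral_itvoo_right c d f F L : c < d ->
  measurable_fun `]c, d[ f -> (forall x, c < x < d -> 0 <= f x) ->
  (forall y, c < y < d -> (\int[mu]_(x in `]c, y]) (f x)%:E = (F y)%:E)%E) ->
  F y @[y --> d^'-] --> L ->
  (\int[mu]_(x in `]c, d[) (f x)%:E = L%:E)%E.
Proof.
move=> cd mf f0 fF FL; have dc0 : 0 < d - c by rewrite subr_gt0.
pose u n : R := d - (d - c) / n.+2%:R.
have u_lt n : c < u n < d.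
  have := gap_lt n dc0; rewrite /u; move: ((d - c) / _) => g /andP[g0 gd].
  by apply/andP; split; lra.
have u_cvg : u n @[n --> \oo] --> d.
  by rewrite -[X in _ --> X]subr0; apply: cvgB; [exact: cvg_cst|exact: cvg_gap].
apply: (@ge0_integral_exhaust (fun n => `]c, u n]%classic) _ _ (F \o u)) => //.
- apply/nondecreasing_seqP => n; rewrite subsetEset; apply: subset_itvl.
  by rewrite bnd_simp lerB// gap_le.
- apply/seteqP; split => [x [n _]|x /=].
    by apply: subset_itvl; rewrite bnd_simp; case/andP: (u_lt n).
  rewrite in_itv/= => /andP[cx xd].
  have [N _ Nu] : \forall n \near \oo, x < u n by exact: (cvgr_gt _ u_cvg).
  by exists N => //=; rewrite in_itv/= cx/= ltW//; exact: (Nu N (leqnn N)).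
- by move=> n; rewrite fF.
- by move: FL => /cvg_at_leftP; apply; split => // n; case/andP: (u_lt n).
Qed.

Lemma ge0_integral_itvoo_left c d f F L : c < d ->
  measurable_fun `]c, d[ f -> (forall x, c < x < d -> 0 <= f x) ->
  (forall y, c < y < d -> (\int[mu]_(x in `[y, d[) (f x)%:E = (F y)%:E)%E) ->
  F y @[y --> c^'+] --> L ->
  (\int[mu]_(x in `]c, d[) (f x)%:E = L%:E)%E.
Proof.
move=> cd mf f0 fF FL; have dc0 : 0 < d - c by rewrite subr_gt0.
pose u n : R := c + (d - c) / n.+2%:R.
have u_lt n : c < u n < d.
  have := gap_lt n dc0; rewrite /u; move: ((d - c) / _) => g /andP[g0 gd].
  by apply/andP; split; lra.
have u_cvg : u n @[n --> \oo] --> c.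
  by rewrite -[X in _ --> X]addr0; apply: cvgD; [exact: cvg_cst|exact: cvg_gap].
apply: (@ge0_integral_exhaust (fun n => `[u n, d[%classic) _ _ (F \o u)) => //.
- apply/nondecreasing_seqP => n; rewrite subsetEset; apply: subset_itvr.
  by rewrite bnd_simp lerD2l gap_le.
- apply/seteqP; split => [x [n _]|x /=].
    by apply: subset_itvr; rewrite bnd_simp; case/andP: (u_lt n).
  rewrite in_itv/= => /andP[cx xd].
  have [N _ Nu] : \forall n \near \oo, u n < x by exact: (cvgr_lt _ u_cvg).
  by exists N => //=; rewrite in_itv/= xd andbT ltW//; exact: (Nu N (leqnn N)).
- by move=> n; rewrite fF.
- by move: FL => /cvg_at_rightP; apply; split => // n; case/andP: (u_lt n).
Qed.

Lemma oriented_integralB c d a x y f : mu.-integrable `[c, d] (EFin \o f) ->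
  c <= a <= d -> c <= x -> x <= y -> y <= d ->
  oriented_integral a y f - oriented_integral a x f =
  \int[mu]_(t in `[x, y]) f t.
Proof.
move=> intf /andP[ca ad] cx xy yd; rewrite /oriented_integral.
have [ax|xa] := leP a x.
  by rewrite (le_trans ax xy) (Rintegral_itv_split intf ca ax xy yd) addrC addKr.
have [ay|ya] := leP a y.
  by rewrite (Rintegral_itv_split intf cx (ltW xa) ay yd) opprK addrC.
by rewrite (Rintegral_itv_split intf cx xy (ltW ya) ad) opprK addrC addrK.
Qed.

End improper.

(** * Integrals of reciprocals *)

Section reciprocal.
Context {R : realType}.
Local Notation mu := (@lebesgue_measure R).

Lemma measurable_invr : measurable_fun [set: R] (@GRing.inv R).
Proof.
rewrite (_ : @GRing.inv R =
  fun x => if 0 <= x then x `^ (-1) else - (- x) `^ (-1)); last first.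
  apply/funext => x; case: ifPn => [x0|]; first by rewrite powR_inv1.
  rewrite -ltNge => x0; rewrite powR_inv1 ?oppr_ge0 1?ltW//.
  by rewrite invrN opprK.
apply: measurable_fun_ifT.
- exact: measurable_fun_ler.
- exact: measurable_powR.
- apply: measurable_funN; 
  apply: (measurableT_comp (f := @powR R ^~ (-1))); first exact: measurable_powR.
  exact: oppr_measurable.
Qed.

Lemma Rintegral_inv (x y : R) : 0 < x -> x <= y ->
  \int[mu]_(t in `[x, y]) t^-1 = ln y - ln x.
Proof.
move=> x0; rewrite le_eqVlt => /predU1P[->|xy].
  by rewrite set_itv1 Rintegral_set1 subrr.
rewrite /Rintegral (@continuous_FTC2 _ (fun t => t^-1) (@ln R))//.
- apply: continuous_in_subspaceT => t /set_mem/=; rewrite in_itv/= => /andP[xt _].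
  by apply: inv_continuous; apply: lt0r_neq0; exact: lt_le_trans xt.
- split.
  + move=> t; rewrite in_itv/= => /andP[xt _].
    by have [] := is_derive1_ln (lt_trans x0 xt).
  + by apply: cvg_at_right_filter; exact: continuous_ln.
  + by apply: cvg_at_left_filter; apply: continuous_ln; exact: lt_trans xy.
- move=> t; rewrite in_itv/= => /andP[xt _]; rewrite derive1E.
  by have [_ ->] := is_derive1_ln (lt_trans x0 xt).
Qed.

Lemma Rintegral_inv_onem (x y : R) : x <= y -> y < 1 ->
  \int[mu]_(t in `[x, y]) (1 - t)^-1 = ln (1 - x) - ln (1 - y).
Proof.
rewrite le_eqVlt => /predU1P[->|xy] y1.
  by rewrite set_itv1 Rintegral_set1 subrr.
have dF (t : R) : t < 1 -> is_derive t 1 (fun t => - ln (1 - t)) (1 - t)^-1.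
  move=> t1; have t0 : 0 < 1 - t by rewrite subr_gt0.
  have d1 : is_derive t 1 (fun t => 1 - t) (0 - 1).
    exact: (is_deriveB (is_derive_cst (1 : R) t (1 : R)) (is_derive_id t (1 : R))).
  have := is_deriveN (is_derive1_comp (f := @ln R) (g := fun t => 1 - t)
    (is_derive1_ln t0) d1).
  by rewrite sub0r mulrN1 opprK.
have xlt1 : x < 1 by exact: lt_trans y1.
have cF (t : R) : t < 1 -> {for t, continuous (fun t : R => - ln (1 - t))}.
  move=> t1; apply: differentiable_continuous; apply/derivable1_diffP.
  by have [] := dF t t1.
rewrite /Rintegral (@continuous_FTC2 _ (fun t => (1 - t)^-1) (fun t : R => - ln (1 - t)))//.
- by rewrite -EFinB/=; ring.
- apply: continuous_in_subspaceT => t /set_mem/=; rewrite in_itv/= => /andP[_ ty].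
  apply: (continuous_comp (f := fun t : R => 1 - t) (g := @GRing.inv R)).
    by apply: cvgB; [exact: cvg_cst|exact: cvg_id].
  by apply: inv_continuous; apply: lt0r_neq0; rewrite subr_gt0 (le_lt_trans ty).
- split.
  + move=> t; rewrite in_itv/= => /andP[_ ty].
    by have [] := dF t (lt_trans ty y1).
  + by apply: cvg_at_right_filter; exact: cF.
  + by apply: cvg_at_left_filter; exact: cF.
- move=> t; rewrite in_itv/= => /andP[_ ty]; rewrite derive1E.
  by have [_ ->] := dF t (lt_trans ty y1).
Qed.

End reciprocal.

(** * The invariant weight *)

Section stationary_density_theory.
Context {R : realType}.
Local Notation mu := (@lebesgue_measure R).
Variables (l r : R) (p : R -> R).
Hypotheses (hl : 0 < l) (hr : 0 < r).
Hypothesis p01 : forall x, 0 <= x <= 1 -> 0 <= p x <= 1.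
Hypothesis mp : measurable_fun `[(0 : R), 1] p.
Implicit Types x y t : R.

(** Multiplied by [p] it is the rate of logarithmic decay of [E], multiplied by
[1 - p] that of logarithmic growth of [G]. *)
Definition hazard x := r / (1 - x) + l / x.

(** The primitive of [hazard] whose exponential is [x^l / (1-x)^r]. *)
Definition log_weight x := l * ln x - r * ln (1 - x).

(** The primitive of [p * hazard] vanishing at 1/2, written with the oriented
integrals that occur in the stationary density. *)
Definition left_clock x :=
  r * oriented_integral (1 / 2) x (fun t => p t / (1 - t)) +
  l * oriented_integral (1 / 2) x (fun t => p t / t).

Local Notation E x := (expR (- left_clock x)).
Local Notation G x := (expR (log_weight x - left_clock x)).

Lemma hazard_gt0 x : 0 < x < 1 -> 0 < hazard x.
Proof. by move=> /andP[x0 x1]; rewrite addr_gt0// divr_gt0// subr_gt0. Qed.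

Lemma measurable_hazard : measurable_fun setT hazard.
Proof.
apply: measurable_funD; apply: measurable_funM => //; last exact: measurable_invr.
by apply: (measurableT_comp measurable_invr); exact: measurable_funB.
Qed.

Let in01 x y t : 0 < x -> y < 1 -> x <= t <= y -> 0 < t < 1.
Proof. by move=> x0 y1 /andP[xt ty]; rewrite (lt_le_trans x0)//= (le_lt_trans ty). Qed.

Let in01w x y t : 0 < x -> y < 1 -> x <= t <= y -> 0 <= t <= 1.
Proof. by move=> x0 y1 /(in01 x0 y1)/andP[/ltW -> /ltW]. Qed.

Let mpS x y : 0 < x -> y < 1 -> measurable_fun `[x, y] p.
Proof.
move=> x0 y1; apply: measurable_funS mp => //.
by apply: subset_itv; rewrite bnd_simp ltW.
Qed.

Let inv_le x t : 0 < x -> x <= t -> t^-1 <= x^-1.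
Proof. by move=> x0 xt; rewrite lef_pV2 ?posrE// (lt_le_trans x0). Qed.

Let int_left x y (q : R -> R) : 0 < x -> y < 1 -> measurable_fun `[x, y] q ->
  (forall t, x <= t <= y -> 0 <= q t <= 1) ->
  mu.-integrable `[x, y] (EFin \o (fun t => q t / t)).
Proof.
move=> x0 y1 mq q01; apply: (@bounded_itv_integrable _ _ _ x^-1).
  by apply: measurable_funM => //; apply: measurable_funTS; exact: measurable_invr.
move=> t xty; have /andP[q0 q1] := q01 _ xty; have /andP[t0 _] := in01 x0 y1 xty.
rewrite ger0_norm; last by rewrite divr_ge0// ltW.
rewrite -[leRHS]mul1r ler_pM ?invr_ge0//; first exact: ltW.
by rewrite inv_le//; case/andP: xty.
Qed.

Let int_right x y (q : R -> R) : 0 < x -> y < 1 -> measurable_fun `[x, y] q ->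
  (forall t, x <= t <= y -> 0 <= q t <= 1) ->
  mu.-integrable `[x, y] (EFin \o (fun t => q t / (1 - t))).
Proof.
move=> x0 y1 mq q01; apply: (@bounded_itv_integrable _ _ _ (1 - y)^-1).
  apply: measurable_funM => //; apply: measurable_funTS.
  by apply: (measurableT_comp measurable_invr); exact: measurable_funB.
move=> t xty; have /andP[q0 q1] := q01 _ xty; have /andP[_ t1] := in01 x0 y1 xty.
have t1' : 0 <= 1 - t by rewrite subr_ge0 ltW.
rewrite ger0_norm; last by rewrite divr_ge0.
rewrite -[leRHS]mul1r ler_pM ?invr_ge0//.
by rewrite inv_le ?subr_gt0// lerB//; case/andP: xty.
Qed.

Let intZ x y k (f : R -> R) : mu.-integrable `[x, y] (EFin \o f) ->
  mu.-integrable `[x, y] (EFin \o (fun t => k * f t)).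
Proof.
by move=> intf; rewrite (_ : _ \o _ = fun t => (k%:E * (EFin \o f) t)%E)//; exact: integrableZl.
Qed.

Let Rintegral_hazard x y (q : R -> R) : 0 < x -> y < 1 -> measurable_fun `[x, y] q ->
  (forall t, x <= t <= y -> 0 <= q t <= 1) ->
  \int[mu]_(t in `[x, y]) (q t * hazard t) =
  r * \int[mu]_(t in `[x, y]) (q t / (1 - t)) +
  l * \int[mu]_(t in `[x, y]) (q t / t).
Proof.
move=> x0 y1 mq q01.
have i1 := int_left x0 y1 mq q01; have i2 := int_right x0 y1 mq q01.
rewrite -!RintegralZl// -RintegralD//; [|exact: intZ|exact: intZ].
by apply: eq_Rintegral => t _; rewrite /hazard; ring.
Qed.

Let pS x y : 0 < x -> y < 1 -> forall t, x <= t <= y -> 0 <= p t <= 1.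
Proof. by move=> x0 y1 t xty; apply: p01; exact: in01w xty. Qed.

Lemma left_clockB x y : 0 < x -> x <= y -> y < 1 ->
  left_clock y - left_clock x = \int[mu]_(t in `[x, y]) (p t * hazard t).
Proof.
move=> x0 xy y1; pose c := Num.min x (1 / 2); pose d := Num.max y (1 / 2).
have c0 : 0 < c by rewrite lt_min x0 divr_gt0.
have d1 : d < 1 by rewrite gt_max y1 ltr_pdivrMr// mul1r ltr1n.
have cad : c <= 1 / 2 <= d by rewrite ge_min lexx orbT le_max lexx orbT.
have cx : c <= x by rewrite ge_min lexx.
have yd : y <= d by rewrite le_max lexx.
rewrite Rintegral_hazard//; [|exact: mpS|exact: pS].
rewrite -(oriented_integralB (int_left c0 d1 (mpS c0 d1) (pS c0 d1)) cad)//.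
rewrite -(oriented_integralB (int_right c0 d1 (mpS c0 d1) (pS c0 d1)) cad)//.
by rewrite /left_clock; ring.
Qed.

Lemma log_weightB x y : 0 < x -> x <= y -> y < 1 ->
  log_weight y - log_weight x = \int[mu]_(t in `[x, y]) hazard t.
Proof.
move=> x0 xy y1.
have -> : \int[mu]_(t in `[x, y]) hazard t = \int[mu]_(t in `[x, y]) (1 * hazard t).
  by apply: eq_Rintegral => t _; rewrite mul1r.
rewrite Rintegral_hazard//; last by move=> ? _; rewrite ler01 lexx.
under eq_Rintegral do rewrite mul1r.
under [X in l * X]eq_Rintegral do rewrite mul1r.
by rewrite Rintegral_inv// Rintegral_inv_onem// /log_weight; ring.
Qed.

Let hazard_le x y t : 0 < x -> y < 1 -> x <= t <= y ->
  hazard t <= r / (1 - y) + l / x.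
Proof.
move=> x0 y1 /andP[xt ty]; apply: lerD; rewrite ler_pM2l//.
  by rewrite inv_le ?subr_gt0// lerB.
exact: inv_le.
Qed.

Let norm_hazard_le x y (q : R -> R) : 0 < x -> y < 1 ->
  (forall t, x <= t <= y -> 0 <= q t <= 1) ->
  forall t, x <= t <= y -> `|q t * hazard t| <= r / (1 - y) + l / x.
Proof.
move=> x0 y1 q01 t xty; have h0 := hazard_gt0 (in01 x0 y1 xty).
have /andP[q0 q1] := q01 _ xty.
rewrite normrM (ger0_norm q0) (gtr0_norm h0) -[leRHS]mul1r.
by apply: ler_pM => //; [exact: ltW|exact: hazard_le].
Qed.

Let int_flow x y : 0 < x -> y < 1 ->
  mu.-integrable `[x, y] (EFin \o (fun t => p t * hazard t)).
Proof.
move=> x0 y1; apply: (@bounded_itv_integrable _ _ _ (r / (1 - y) + l / x)).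
  by apply: measurable_funM; [exact: mpS|apply: measurable_funTS; exact: measurable_hazard].
by apply: norm_hazard_le => //; exact: pS.
Qed.

(** Here [E] decreases: the identity is the exponential one for the primitive
[- left_clock], with both sides negated. *)
Lemma integral_left_flow x y : 0 < x -> x <= y -> y < 1 ->
  (\int[mu]_(t in `[x, y]) (p t * hazard t * E t)%:E = (E x - E y)%:E)%E.
Proof.
move=> x0 xy y1.
have mph : measurable_fun `[x, y] (fun t => p t * hazard t).
  by apply: measurable_funM; [exact: mpS|apply: measurable_funTS; exact: measurable_hazard].
have key : (\int[mu]_(t in `[x, y]) (- (p t * hazard t) * E t)%:E =
    (E y - E x)%:E)%E.
  apply: (@integral_mul_expR _ x y (r / (1 - y) + l / x)) => //.
  - exact: measurable_funN.
  - move=> t xty; rewrite normrN; apply: norm_hazard_le => //; exact: pS.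
  - move=> u v xu uv vy; have u0 := lt_le_trans x0 xu; have v1 := le_lt_trans vy y1.
    rewrite opprK addrC -opprB left_clockB// -mulN1r -RintegralZl//.
      by apply: eq_Rintegral => t _; rewrite mulN1r.
    exact: int_flow.
move: key; rewrite (_ : (\int[mu]_(t in _) _)%E =
    (- \int[mu]_(t in `[x, y]) (p t * hazard t * E t)%:E)%E); last first.
  rewrite -integral_ge0N/=; last first.
    move=> t; rewrite /= in_itv/= => xty; rewrite lee_fin mulr_ge0 ?expR_ge0//.
    have /andP[p0 _] := pS x0 y1 xty.
    by rewrite mulr_ge0//; apply/ltW/hazard_gt0; exact: in01 xty.
  by apply: eq_integral => t _; rewrite mulNr EFinN.
by move=> /(congr1 oppe); rewrite oppeK => ->; rewrite -EFinN opprB.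
Qed.

Let right_flowB u v : 0 < u -> u <= v -> v < 1 ->
  (log_weight v - left_clock v) - (log_weight u - left_clock u) =
  \int[mu]_(t in `[u, v]) ((1 - p t) * hazard t).
Proof.
move=> u0 uv v1.
have -> : log_weight v - left_clock v - (log_weight u - left_clock u) =
    (log_weight v - log_weight u) - (left_clock v - left_clock u) by ring.
rewrite log_weightB// left_clockB// -RintegralB//; last exact: int_flow.
  by apply: eq_Rintegral => t _; ring.
apply: (@bounded_itv_integrable _ _ _ (r / (1 - v) + l / u)).
  by apply: measurable_funTS; exact: measurable_hazard.
move=> t utv; have := @norm_hazard_le u v (cst 1) u0 v1 _ t utv.
by rewrite mul1r; apply => ? _; rewrite ler01 lexx.
Qed.

Lemma integral_right_flow x y : 0 < x -> x <= y -> y < 1 ->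
  (\int[mu]_(t in `[x, y]) ((1 - p t) * hazard t * G t)%:E = (G y - G x)%:E)%E.
Proof.
move=> x0 xy y1.
apply: (@integral_mul_expR _ x y (r / (1 - y) + l / x)) => //.
- apply: measurable_funM; last by apply: measurable_funTS; exact: measurable_hazard.
  by apply: measurable_funB => //; exact: mpS.
- apply: norm_hazard_le => // t xty.
  by have := pS x0 y1 xty; move=> /andP[p0 p1]; rewrite subr_ge0 p1 gerBl.
- move=> u v xu uv vy.
  by rewrite right_flowB// ?(lt_le_trans x0)// (le_lt_trans vy).
Qed.


Let measurable_E : measurable_fun `](0 : R), 1[ (fun x => E x).
Proof.
apply: measurableT_comp => //; apply: measurable_funN.
apply: nondecreasing_itv_measurable => x y.
rewrite !in_itv/= => /andP[x0 _] /andP[_ y1] xy.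
rewrite -subr_ge0 left_clockB//; apply: Rintegral_ge0 => t/=; rewrite in_itv/= => xty.
have /andP[p0 _] := pS x0 y1 xty.
by rewrite mulr_ge0//; apply/ltW/hazard_gt0; exact: in01 xty.
Qed.

Let measurable_log_weight : measurable_fun setT log_weight.
Proof.
apply: measurable_funB; apply: measurable_funM => //.
by apply: measurableT_comp => //; exact: measurable_funB.
Qed.

Let GE x : G x = expR (log_weight x) * E x.
Proof. by rewrite expRD. Qed.

Let measurable_G : measurable_fun `](0 : R), 1[ (fun x => G x).
Proof.
rewrite (_ : (fun x => _) = (fun x => expR (log_weight x) * E x)); last first.
  by apply/funext => x; exact: GE.
apply: measurable_funM => //; apply: measurable_funTS.
exact: measurableT_comp.
Qed.

Let measurable_p : measurable_fun `](0 : R), 1[ p.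
Proof.
by apply: measurable_funS mp => //; apply: subset_itvW.
Qed.

Variables delta eps : R.
Hypothesis hdelta : 0 < delta < 1 / 2.
Hypothesis heps : 0 < eps <= 1.
Hypothesis p_left : forall x, 0 <= x <= delta -> p x <= 1 - eps.
Hypothesis p_right : forall x, 1 - delta <= x <= 1 -> eps <= p x.

Let delta0 : 0 < delta. Proof. by case/andP: hdelta. Qed.
Let delta1 : delta < 1 / 2. Proof. by case/andP: hdelta. Qed.
Let eps0 : 0 < eps. Proof. by case/andP: heps. Qed.

(** Near 1 the clock runs at least at speed [eps * r / (1 - t)], so that [E] decays
like a power of [1 - y]. *)
Let E_le y : 1 - delta <= y -> y < 1 ->
  E y <= E (1 - delta) * expR (- (eps * r * ln delta)) * (1 - y) `^ (eps * r).
Proof.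
move=> dy y1; have d0 : 0 < 1 - delta by have := delta1; lra.
have y1' : 0 < 1 - y by rewrite subr_gt0.
rewrite /powR gt_eqF// -!expRD ler_expR.
have : \int[mu]_(t in `[1 - delta, y]) (eps * r * (1 - t)^-1) <=
    \int[mu]_(t in `[1 - delta, y]) (p t * hazard t).
  apply: le_Rintegral => //.
  - apply: intZ; rewrite (_ : (fun t => _) = (fun t => 1 / (1 - t))).
      by apply: (int_right (q := cst 1)) => // ? _; rewrite ler01 lexx.
    by apply/funext => t; rewrite div1r.
  - exact: int_flow.
  - move=> t; rewrite /= in_itv/= => dty; have /andP[t0 t1] := in01 d0 y1 dty.
    have ept : eps <= p t by by apply: p_right; move/andP: dty => [-> _]; rewrite ltW.
    rewrite -mulrA; apply: ler_pM => //; first exact: ltW.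
      by apply/ltW/divr_gt0; rewrite // subr_gt0.
    by rewrite /hazard lerDl; apply/ltW/divr_gt0.
rewrite RintegralZl//; last first.
  rewrite (_ : (fun t => _) = (fun t => 1 / (1 - t))).
    by apply: (int_right (q := cst 1)) => // ? _; rewrite ler01 lexx.
  by apply/funext => t; rewrite div1r.
rewrite Rintegral_inv_onem// -left_clockB// subKr.
nra.
Qed.

Let E_cvg : E y @[y --> 1^'-] --> 0.
Proof.
apply/cvg_at_leftP => u [u1 uc].
set c := E (1 - delta) * expR (- (eps * r * ln delta)).
apply: (@squeeze_cvgr _ _ _ _ (cst 0) (fun n => c * (1 - u n) `^ (eps * r))).
- have : \forall n \near \oo, 1 - delta < u n.
    by apply: (cvgr_gt _ uc); rewrite ltrBlDr ltrDl.
  apply: filterS => n /ltW dn; rewrite expR_ge0/=; exact: E_le.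
- exact: cvg_cst.
- rewrite -[X in _ --> X](mulr0 c); apply: cvgM; first exact: cvg_cst.
  have /cvg_at_rightP := powR_cvg0 (mulr_gt0 eps0 hr); apply; split.
    by move=> n; rewrite subr_gt0.
  by rewrite -[X in _ --> X](subrr 1); apply: cvgB => //; exact: cvg_cst.
Qed.

(** Mirror image of the previous bound: near 0, [1 - p] is at least [eps]. *)
Let G_le x : 0 < x -> x <= delta ->
  G x <= G delta * expR (- (eps * l * ln delta)) * x `^ (eps * l).
Proof.
move=> x0 xd; have d1 : delta < 1 by have := delta1; lra.
rewrite /powR gt_eqF// -!expRD ler_expR.
have i1 : mu.-integrable `[x, delta] (EFin \o (fun t => t^-1)).
  rewrite (_ : (fun t => _) = (fun t => 1 / t)).
    by apply: (int_left (q := cst 1)) => // ? _; rewrite ler01 lexx.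
  by apply/funext => t; rewrite div1r.
have : \int[mu]_(t in `[x, delta]) (eps * l * t^-1) <=
    \int[mu]_(t in `[x, delta]) ((1 - p t) * hazard t).
  apply: le_Rintegral => //.
  - exact: intZ.
  - apply: (@bounded_itv_integrable _ _ _ (r / (1 - delta) + l / x)).
      apply: measurable_funM; last by apply: measurable_funTS; exact: measurable_hazard.
      by apply: measurable_funB => //; exact: mpS.
    apply: norm_hazard_le => // t xty; have /andP[p0 p1] := pS x0 d1 xty.
    by rewrite subr_ge0 p1 gerBl.
  - move=> t; rewrite /= in_itv/= => xty; have /andP[t0 t1] := in01 x0 d1 xty.
    have ept : p t <= 1 - eps by apply: p_left; move/andP: xty => [_ ->]; rewrite ltW.
    rewrite -mulrA; apply: ler_pM.
    + exact: ltW.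
    + exact/ltW/divr_gt0.
    + by rewrite lerBrDl -lerBrDr.
    + by rewrite /hazard lerDr; apply/ltW/divr_gt0; rewrite // subr_gt0.
rewrite RintegralZl// Rintegral_inv// -right_flowB//.
nra.
Qed.

Let G_cvg : G x @[x --> 0^'+] --> 0.
Proof.
apply/cvg_at_rightP => u [u0 uc].
set c := G delta * expR (- (eps * l * ln delta)).
apply: (@squeeze_cvgr _ _ _ _ (cst 0) (fun n => c * (u n) `^ (eps * l))).
- have : \forall n \near \oo, u n < delta by exact: (cvgr_lt _ uc).
  by apply: filterS => n /ltW dn; rewrite expR_ge0/=; exact: G_le.
- exact: cvg_cst.
- rewrite -[X in _ --> X](mulr0 c); apply: cvgM; first exact: cvg_cst.
  by have /cvg_at_rightP := powR_cvg0 (mulr_gt0 eps0 hl); apply; split.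
Qed.

Let measurable_left_flow : measurable_fun `](0 : R), 1[ (fun t => p t * hazard t * E t).
Proof.
apply: measurable_funM => //; apply: measurable_funM => //.
by apply: measurable_funTS; exact: measurable_hazard.
Qed.

Let measurable_right_flow :
  measurable_fun `](0 : R), 1[ (fun t => (1 - p t) * hazard t * G t).
Proof.
apply: measurable_funM => //; apply: measurable_funM => //.
  exact: measurable_funB.
by apply: measurable_funTS; exact: measurable_hazard.
Qed.

Let p01' t : 0 < t < 1 -> 0 <= p t <= 1.
Proof. by move=> /andP[t0 t1]; apply: p01; rewrite !ltW. Qed.

(** [E] vanishes at 1, so nothing is lost in the limit of the bounded identity. *)
Lemma integral_left_tail y : 0 < y < 1 ->
  (\int[mu]_(t in `]y, 1%R[) (p t * hazard t * E t)%:E = (E y)%:E)%E.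
Proof.
move=> /andP[y0 y1]; have sub : `]y, 1[%classic `<=` `]0, 1[%classic.
  by apply: subset_itvr; rewrite bnd_simp ltW.
apply: (@ge0_integral_itvoo_right _ _ _ _ (fun b => E y - E b)) => //.
- exact: measurable_funS measurable_left_flow.
- move=> t /andP[yt t1]; have t01 : 0 < t < 1 by rewrite (lt_trans y0).
  have /andP[p0 _] := p01' t01.
  by rewrite mulr_ge0 ?expR_ge0// mulr_ge0// ltW// hazard_gt0.
- move=> b /andP[yb b1]; rewrite integral_itv_obnd_cbnd.
    by rewrite integral_left_flow// ltW.
  apply/measurable_EFinP; apply: measurable_funS measurable_left_flow => //.
  by apply: subset_itv; rewrite bnd_simp// ltW.
- by rewrite -[X in _ --> X]subr0; apply: cvgB => //; exact: cvg_cst.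
Qed.

(** [G] vanishes at 0. *)
Lemma integral_right_head y : 0 < y < 1 ->
  (\int[mu]_(t in `]0%R, y[) ((1 - p t) * hazard t * G t)%:E = (G y)%:E)%E.
Proof.
move=> /andP[y0 y1]; have sub : `]0, y[%classic `<=` `]0, 1[%classic.
  by apply: subset_itvl; rewrite bnd_simp ltW.
apply: (@ge0_integral_itvoo_left _ _ _ _ (fun b => G y - G b)) => //.
- exact: measurable_funS measurable_right_flow.
- move=> t /andP[t0 ty]; have t01 : 0 < t < 1 by rewrite t0 (lt_trans ty).
  have /andP[_ p1] := p01' t01.
  by rewrite mulr_ge0 ?expR_ge0// mulr_ge0 ?subr_ge0// ltW// hazard_gt0.
- move=> b /andP[b0 yb]; rewrite integral_itv_bndo_bndc.
    by rewrite integral_right_flow// ltW.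
  apply/measurable_EFinP; apply: measurable_funS measurable_right_flow => //.
  by apply: subset_itv; rewrite bnd_simp// ltW.
- by rewrite -[X in _ --> X]subr0; apply: cvgB => //; exact: cvg_cst.
Qed.


(** The stationary density up to normalisation. *)
Definition weight x := x `^ l * hazard x * E x.

Lemma stationary_densityE C x : stationary_density l r p C x = C * weight x.
Proof.
rewrite /stationary_density /weight -!mulrA; congr (C * (_ * (_ * expR _))).
by rewrite /left_clock opprD mulNr.
Qed.

Let powE x a : 0 < x -> x `^ a = expR (a * ln x).
Proof. by move=> x0; rewrite /powR gt_eqF. Qed.

Let GwE x : 0 < x < 1 -> G x = x `^ l / (1 - x) `^ r * E x.
Proof.
move=> /andP[x0 x1]; rewrite GE /log_weight expRD -mulNr -!powE ?subr_gt0//.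
by rewrite powRN.
Qed.

Lemma weight_gt0 x : 0 < x < 1 -> 0 < weight x.
Proof.
move=> x01; have /andP[x0 _] := x01.
by rewrite mulr_gt0 ?expR_gt0// mulr_gt0 ?powR_gt0// hazard_gt0.
Qed.

Lemma measurable_weight : measurable_fun `](0 : R), 1[ weight.
Proof.
apply: measurable_funM => //; apply: measurable_funM.
  by apply: measurable_funTS; exact: measurable_powR.
by apply: measurable_funTS; exact: measurable_hazard.
Qed.

Lemma left_flow_weight x : 0 < x < 1 ->
  p x * weight x / x `^ l = p x * hazard x * E x.
Proof.
move=> /andP[x0 _]; rewrite /weight; have := powR_gt0 l x0.
by move: (x `^ l) => k /lt0r_neq0 k0; field.
Qed.

Lemma right_flow_weight x : 0 < x < 1 ->
  (1 - p x) * weight x / (1 - x) `^ r = (1 - p x) * hazard x * G x.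
Proof.
move=> x01; rewrite /weight GwE//; have /andP[x0 x1] := x01.
have x1' : 0 < 1 - x by rewrite subr_gt0.
have := powR_gt0 r x1'.
by move: ((1 - x) `^ r) => k /lt0r_neq0 k0; field.
Qed.

Lemma weight_balance x : 0 < x < 1 ->
  weight x = l * x `^ (l - 1) * E x + r * (1 - x) `^ (r - 1) * G x.
Proof.
move=> x01; rewrite /weight GwE//; have /andP[x0 x1] := x01.
have x1' : 0 < 1 - x by rewrite subr_gt0.
rewrite !powRB; last 2 first.
- by apply/implyP => _; exact: lt0r_neq0.
- by apply/implyP => _; exact: lt0r_neq0.
rewrite !powRr1; [|exact: ltW..]; rewrite /hazard; have := powR_gt0 r x1'.
move: ((1 - x) `^ r) => k /lt0r_neq0 k0; field.
by rewrite k0 !lt0r_neq0.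
Qed.

Let flow_ge0 x : 0 < x < 1 ->
  0 <= p x * hazard x * E x /\ 0 <= (1 - p x) * hazard x * G x.
Proof.
move=> x01; have /andP[p0 p1] := p01' x01; have h0 := hazard_gt0 x01.
by split; rewrite mulr_ge0 ?expR_ge0// mulr_ge0 ?subr_ge0// ltW.
Qed.

Let weight_le x : 0 < x < 1 -> weight x <= hazard x * E x /\ weight x <= hazard x * G x.
Proof.
move=> x01; have /andP[x0 x1] := x01.
have x1' : 0 < 1 - x by rewrite subr_gt0.
have h0 := ltW (hazard_gt0 x01); have E0 := expR_ge0 (- left_clock x).
have xl1 : x `^ l <= 1.
  by rewrite -(powRr0 x) ger_powR ?x0 ?ltW.
have y1 : 1 <= ((1 - x) `^ r)^-1.
  rewrite -powRN -[leLHS](powRr0 (1 - x)) ger_powR ?x1'//=.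
    by rewrite gerBl ltW.
  by rewrite oppr_le0 ltW.
split.
  by rewrite /weight -mulrA -[leRHS]mul1r ler_wpM2r// mulr_ge0.
rewrite GwE// /weight.
rewrite (_ : _ * (_ * _ * _) = (x `^ l * hazard x * E x) * ((1 - x) `^ r)^-1).
  by rewrite -[leLHS]mulr1 ler_wpM2l// mulr_ge0// mulr_ge0 ?powR_ge0.
by ring.
Qed.

(** The weight is at most [hazard * E] and at most [hazard * G].  Left of
[1 - delta] the latter is controlled by [(1 - p) * hazard * G] near 0, right of
[delta] the former by [p * hazard * E] near 1, and in the middle by the sum of
both; the two flows have finite integrals. *)
Lemma integral_weight_lty :
  (\int[mu]_(x in `]0%R, 1%R[) (weight x)%:E < +oo)%E.
Proof.
have [dl0 dl1] := (delta0, delta1).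
have d01 : 0 < delta < 1 by apply/andP; split; lra.
have d01' : 0 < 1 - delta < 1 by apply/andP; split; lra.
have [d0 d1] := andP d01; have [d0' d1'] := andP d01'.
have ddl : delta < 1 - delta by have := delta1; lra.
pose f1 x := (p x * hazard x * E x)%:E.
pose f2 x := ((1 - p x) * hazard x * G x)%:E.
have m1 : measurable_fun `](0 : R), 1[ f1 by exact/measurable_EFinP.
have m2 : measurable_fun `](0 : R), 1[ f2 by exact/measurable_EFinP.
have s1 : `]delta, 1[%classic `<=` `]0, 1[%classic.
  by apply: subset_itvr; rewrite bnd_simp ltW.
have s2 : `]0, 1 - delta[%classic `<=` `]0, 1[%classic.
  by apply: subset_itvl; rewrite bnd_simp ltW.
pose g x := ((eps^-1)%:E * ((f1 \_ `]delta, 1%R[) x + (f2 \_ `]0%R, (1 - delta)%R[) x))%E.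
have g10 x : (0 <= (f1 \_ `]delta, 1%R[) x)%E.
  apply: erestrict_ge0 => {}x /s1/=; rewrite in_itv/= => /flow_ge0[+ _].
  by rewrite lee_fin.
have g20 x : (0 <= (f2 \_ `]0%R, (1 - delta)%R[) x)%E.
  apply: erestrict_ge0 => {}x /s2/=; rewrite in_itv/= => /flow_ge0[_].
  by rewrite lee_fin.
have mg1 : measurable_fun `](0 : R), 1[ (f1 \_ `]delta, 1%R[).
  by apply: measurable_funTS; apply/(measurable_restrictT f1) => //; exact: measurable_funS m1.
have mg2 : measurable_fun `](0 : R), 1[ (f2 \_ `]0%R, (1 - delta)%R[).
  by apply: measurable_funTS; apply/(measurable_restrictT f2) => //; exact: measurable_funS m2.
have wg : (\int[mu]_(x in `]0%R, 1%R[) (weight x)%:E <= \int[mu]_(x in `]0%R, 1%R[) g x)%E.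
  apply: ge0_le_integral => //.
  - move=> x; rewrite /= in_itv/= => x01; rewrite lee_fin ltW// weight_gt0//.
  - by apply/measurable_EFinP; exact: measurable_weight.
  - by apply: emeasurable_funM => //; exact: emeasurable_funD.
  - move=> x; rewrite /= in_itv/= => x01; have /andP[x0 x1] := x01.
    have [wE wG] := weight_le x01; have [F1 F2] := flow_ge0 x01.
    have /andP[p0 p1] := p01' x01; have w0 := ltW (weight_gt0 x01).
    rewrite /g !patchE !mem_setE !in_itv/= x0 x1 andbT.
    have hE0 : 0 <= hazard x * E x by rewrite mulr_ge0 ?expR_ge0// ltW// hazard_gt0.
    have hG0 : 0 <= hazard x * G x by rewrite mulr_ge0 ?expR_ge0// ltW// hazard_gt0.
    have e1 : 1 <= eps^-1 by rewrite invf_ge1//; case/andP: heps.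
    have [xd|dx] := leP x delta.
      rewrite (le_lt_trans xd ddl) add0e -EFinM lee_fin.
      rewrite ler_pdivlMl// -mulrA ler_pM// ?(ltW eps0)//.
      by have := p_left; move=> /(_ x); rewrite ltW// xd => /(_ isT); lra.
    have [xd|dx'] := ltP x (1 - delta).
      rewrite -EFinD -EFinM lee_fin.
      apply: (@le_trans _ _ (1 * (p x * hazard x * E x + (1 - p x) * hazard x * G x))).
        rewrite mul1r -[leLHS]mul1r -[X in X * _](subrK (p x)) addrC mulrDl.
        by rewrite -!mulrA lerD// ler_wpM2l// subr_ge0.
      by rewrite ler_wpM2r// addr_ge0.
    rewrite adde0 -EFinM lee_fin ler_pdivlMl// -mulrA ler_pM// ?(ltW eps0)//.
    by apply: p_right; rewrite dx' ltW.
apply: (le_lt_trans wg).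
rewrite ge0_integralZl//; last 3 first.
- exact: emeasurable_funD.
- by move=> x _; rewrite adde_ge0.
- by rewrite lee_fin invr_ge0 ltW.
rewrite ge0_integralD// -!integral_mkcondr.
rewrite (setIidr s1) (setIidr s2) integral_left_tail// integral_right_head//.
by rewrite -EFinD -EFinM ltry.
Qed.

(** On [(1/2, 1)] the weight exceeds [(1/2)^l * p * hazard * E], whose integral is
known and positive. *)
Lemma integral_weight_gt0 :
  (0 < \int[mu]_(x in `]0%R, 1%R[) (weight x)%:E)%E.
Proof.
have h01 : 0 < (1 / 2 : R) < 1 by apply/andP; split; lra.
have sub : `](1 / 2 : R), 1[%classic `<=` `](0 : R), 1[%classic.
  by apply: subset_itvr; rewrite bnd_simp ltW//; case/andP: h01.
apply: (@lt_le_trans _ _ (((1 / 2) `^ l)%:E *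
    \int[mu]_(x in `](1 / 2)%R, 1%R[) (p x * hazard x * E x)%:E)%E).
  by rewrite integral_left_tail// -EFinM lte_fin mulr_gt0 ?expR_gt0// powR_gt0//; lra.
apply: (@le_trans _ _ (\int[mu]_(x in `](1 / 2)%R, 1%R[) (weight x)%:E)%E); last first.
  apply: ge0_subset_integral => //; first by apply/measurable_EFinP; exact: measurable_weight.
  by move=> x; rewrite /= in_itv/= => x01; rewrite lee_fin ltW// weight_gt0.
rewrite -ge0_integralZl//; last 2 first.
- by apply/measurable_EFinP; apply: measurable_funS measurable_left_flow.
- move=> x /sub; rewrite /= in_itv/= => /flow_ge0[+ _]; by rewrite lee_fin.
apply: ge0_le_integral => //.
- move=> x /sub; rewrite /= in_itv/= => /flow_ge0[+ _].
  by move=> ?; rewrite mule_ge0// lee_fin powR_ge0.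
- apply: emeasurable_funM => //.
  by apply/measurable_EFinP; apply: measurable_funS measurable_left_flow.
- by apply/measurable_EFinP; apply: measurable_funS measurable_weight.
- move=> x xh; have := sub _ xh; rewrite /= in_itv/= => x01.
  move: xh; rewrite /= in_itv/= => /andP[hx _]; have /andP[x0 x1] := x01.
  have /andP[p0 p1] := p01' x01; have h0 := ltW (hazard_gt0 x01).
  rewrite -EFinM lee_fin /weight mulrA; apply: ler_wpM2r; first exact: expR_ge0.
  rewrite mulrA; apply: ler_wpM2r => //.
  rewrite -[leRHS]mulr1 ler_pM ?powR_ge0//.
  by apply: ge0_ler_powR; rewrite ?nnegrE ?ltW//; case/andP: h01.
Qed.

End stationary_density_theory.

(** * Beta innovations and the transition operator *)

Section beta_integral.
Context {R : realType}.
Local Notation mu := (@lebesgue_measure R).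

Let integral_powR_onem (l : R) : 0 < l ->
  (\int[mu]_(x in `]0%R, 1%R[) ((1 - x) `^ (l - 1))%:E = (l^-1)%:E)%E.
Proof.
move=> l0.
have mpow : measurable_fun setT (fun x : R => (1 - x) `^ (l - 1)).
  apply: (measurableT_comp (f := @powR R ^~ (l - 1))); first exact: measurable_powR.
  exact: measurable_funB.
apply: (@ge0_integral_itvoo_right _ _ _ _ (fun y => l^-1 - l^-1 * (1 - y) `^ l)) => //.
- exact: measurable_funTS.
- by move=> x _; exact: powR_ge0.
- move=> y /andP[y0 y1]; rewrite integral_itv_obnd_cbnd; last first.
    by apply/measurable_EFinP; exact: measurable_funTS.
  have inv1 t : 0 <= t <= y -> 0 < 1 - t by move=> /andP[_ ty]; rewrite subr_gt0 (le_lt_trans ty).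
  have minv : measurable_fun `[0, y] (fun t : R => (1 - t)^-1).
    apply: measurable_funTS; apply: (measurableT_comp (@measurable_invr R)).
    exact: measurable_funB.
  have key : (\int[mu]_(t in `[0%R, y]) ((- l * (1 - t)^-1) * expR (l * ln (1 - t)))%:E =
      (expR (l * ln (1 - y)) - expR (l * ln (1 - 0)))%:E)%E.
    apply: (@integral_mul_expR _ 0 y (l / (1 - y))); first exact: ltW.
    - exact: measurable_funM.
    - move=> t ty; have t1 := inv1 _ ty; have y1' : 0 < 1 - y by rewrite subr_gt0.
      rewrite normrM normrN !gtr0_norm// ?invr_gt0// ler_pM2l// lef_pV2 ?posrE// lerB//.
      by case/andP: ty.
    - move=> u v u0 uv vy; have v1 := le_lt_trans vy y1.
      rewrite RintegralZl//.
        by rewrite Rintegral_inv_onem//; ring.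
      apply: (@bounded_itv_integrable _ _ _ (1 - v)^-1).
        by apply: measurable_funS minv => //; apply: subset_itv; rewrite bnd_simp.
      move=> t /andP[ut tv]; have tv' := le_lt_trans tv v1.
      rewrite gtr0_norm ?invr_gt0 ?subr_gt0// lef_pV2 ?posrE ?subr_gt0//.
      by rewrite lerB.
  set X := (\int[mu]_(x in _) _)%E.
  have {}key : (l%:E * X = (1 - (1 - y) `^ l)%:E)%E.
    rewrite -ge0_integralZl//; last 3 first.
    - by apply/measurable_EFinP; exact: measurable_funTS.
    - by move=> t _; rewrite lee_fin powR_ge0.
    - by rewrite lee_fin ltW.
    apply: oppe_inj; rewrite -integral_ge0N; last first.
      by move=> t _; apply: mule_ge0; rewrite lee_fin ?powR_ge0// ltW.
    transitivity (expR (l * ln (1 - y)) - expR (l * ln (1 - 0)))%:E.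
      rewrite -key; apply: eq_integral => t; rewrite inE/= in_itv/= => /inv1 t1.
      rewrite powRB; last by apply/implyP => _; exact: lt0r_neq0.
      by rewrite powRr1 ?ltW// /powR gt_eqF//; congr EFin; ring.
    by rewrite subr0 ln1 mulr0 expR0 /powR gt_eqF ?subr_gt0// -EFinN opprB.
  have -> : X = (l^-1%:E * (l%:E * X))%E.
    by rewrite muleA -EFinM mulVf ?gt_eqF// mul1e.
  by rewrite key -EFinM mulrBr mulr1.
- rewrite -[X in _ --> X]subr0; apply: cvgB; first exact: cvg_cst.
  rewrite -[X in _ --> X](mulr0 l^-1); apply: cvgM; first exact: cvg_cst.
  apply/cvg_at_leftP => u [u1 uc].
  have /cvg_at_rightP := powR_cvg0 l0; apply; split.
    by move=> n; rewrite subr_gt0.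
  by rewrite -[X in _ --> X](subrr 1); apply: cvgB => //; exact: cvg_cst.
Qed.

Lemma rbeta_pdf1E (l x : R) : 0 < l -> rbeta_pdf 1 l x =
  if 0 < x < 1 then l * (1 - x) `^ (l - 1) else 0.
Proof.
move=> l0; rewrite /rbeta_pdf; case: ifP => // _.
rewrite subrr powRr0 mul1r mulrC; congr (_ * _).
rewrite /rbeta_fun /Rintegral -[RHS]invrK; congr (_^-1).
transitivity (fine (l^-1)%:E) => //; rewrite -integral_powR_onem//.
by congr fine; apply: eq_integral => t _; rewrite subrr powRr0 mul1r.
Qed.

(** The beta law as a probability.  The positivity proof is an argument so that the
total mass can be attached to it, while [beta1_law] unfolds to [rbeta_law]. *)
Definition beta1_law (l : R) (l0 : 0 < l) : set (measurableTypeR R) -> \bar R :=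
  rbeta_law 1 l.

HB.instance Definition _ l l0 := Measure.on (@beta1_law l l0).

Let beta1_law_setT (l : R) (l0 : 0 < l) : beta1_law l0 setT = 1%E.
Proof.
rewrite /beta1_law /rbeta_law.
transitivity (\int[mu]_(x in `]0%R, 1%R[) (l%:E * ((1 - x) `^ (l - 1))%:E))%E.
  rewrite [RHS]integral_mkcond; apply: eq_integral => x _.
  by rewrite rbeta_pdf1E// patchE mem_setE in_itv/=; case: ifP.
rewrite ge0_integralZl//; last 3 first.
- apply/measurable_EFinP; apply: measurable_funTS.
  apply: (measurableT_comp (f := @powR R ^~ (l - 1))); first exact: measurable_powR.
  exact: measurable_funB.
- by move=> x _; rewrite lee_fin powR_ge0.
- by rewrite lee_fin ltW.
by rewrite integral_powR_onem// -EFinM divff// gt_eqF.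
Qed.

HB.instance Definition _ l l0 :=
  Measure_isProbability.Build _ _ _ (@beta1_law l l0) (beta1_law_setT l0).

Lemma ge0_integral_beta1 (l : R) (l0 : 0 < l) (f : R -> \bar R) :
  measurable_fun setT f -> (forall x, 0 <= f x)%E ->
  (\int[beta1_law l0]_x f x =
   \int[mu]_(x in `]0%R, 1%R[) (f x * (l * (1 - x) `^ (l - 1))%:E))%E.
Proof.
move=> mf f0.
rewrite (@ge0_integral_density _ _ _ (beta1_law l0) mu (rbeta_pdf 1 l))//; last 2 first.
- exact: rbeta_pdf_ge0.
- exact: measurable_rbeta_pdf.
rewrite [RHS]integral_mkcond; apply: eq_integral => x _.
rewrite rbeta_pdf1E// patchE mem_setE in_itv/=.
by case: ifP => // _; rewrite mule0.
Qed.

End beta_integral.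

Section innovation.
Context {R : realType}.
Local Notation M := (measurableTypeR R).
Variables (bl br : probability M R) (p : R -> R).

Definition jump_law : set (M * M) -> \bar R := (bl \x br)%E.

HB.instance Definition _ := Probability.on jump_law.

Definition innovation_law : set (M * M * M) -> \bar R :=
  (jump_law \x uniform_prob (@ltr01 R))%E.

HB.instance Definition _ := Probability.on innovation_law.

(** The transition of the chain as a map of the state and one triple of
innovations. *)
Definition step (z : M * (M * M * M)) : M := chain_step p z.1 z.2.1.1 z.2.1.2 z.2.2.

Hypothesis mp : measurable_fun `[(0 : R), 1] p.

Let indic_lt (c u : R) : \1_[set v | v < c] u = (u < c)%R%:R :> R.
Proof. by rewrite indicE; congr (nat_of_bool _)%:R; apply/idP/idP; rewrite inE. Qed.

Lemma chain_stepE x lam rho u : 0 <= x <= 1 ->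
  chain_step p x lam rho u = if u < p x then x - x * lam else x + (1 - x) * rho.
Proof.
move=> x01; rewrite /chain_step in_itv/= x01 indic_lt.
by case: (u < p x); rewrite /=; ring.
Qed.

Lemma measurable_step : measurable_fun setT step.
Proof.
pose p' (x : R) := if x \in `[0, 1] then p x else 0.
have mp' : measurable_fun [set: M] p'.
  rewrite (_ : p' = p \_ `[0, 1]); last by apply/funext => x; rewrite patchE mem_setE.
  by apply/(measurable_restrictT p).
pose T := (M * (M * M * M))%type.
have mx : measurable_fun [set: T] (fun z : T => z.1 : R) by exact: measurable_fst.
have mv : measurable_fun [set: T] (fun z : T => z.2) by exact: measurable_snd.
have mlr : measurable_fun [set: T] (fun z : T => z.2.1) by exact: measurableT_comp mv.
have mlam : measurable_fun [set: T] (fun z : T => z.2.1.1 : R) by exact: measurableT_comp mlr.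
have mrho : measurable_fun [set: T] (fun z : T => z.2.1.2 : R) by exact: measurableT_comp mlr.
have mu' : measurable_fun [set: T] (fun z : T => z.2.2 : R) by exact: measurableT_comp mv.
have mI : measurable_fun [set: T] (fun z : T => \1_[set v | v < p' z.1] z.2.2 : R).
  rewrite (_ : (fun z => _) = (fun z : T => if z.2.2 < p' z.1 then 1 else 0 : R)).
    apply: measurable_fun_ifT => //; apply: measurable_fun_ltr => //.
    exact: measurableT_comp mx.
  by apply/funext => z; rewrite indic_lt; case: ifP.
have mD := measurable_funM (measurable_funM mx mlam) mI.
have m1 : measurable_fun [set: T] (cst (1 : R)) by [].
have mU := measurable_funM (measurable_funM (measurable_funB m1 mx) mrho)
  (measurable_funB m1 mI).
exact: measurable_funD (measurable_funB mx mD) mU.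
Qed.

End innovation.

Section transition_operator.
Context {R : realType}.
Local Notation mu := (@lebesgue_measure R).
Local Notation M := (measurableTypeR R).
Variables (l r : R) (p : R -> R).
Hypotheses (hl : 0 < l) (hr : 0 < r).
Hypothesis p01 : forall x, 0 <= x <= 1 -> 0 <= p x <= 1.
Hypothesis mp : measurable_fun `[(0 : R), 1] p.

Local Notation bl := (beta1_law hl).
Local Notation br := (beta1_law hr).
Local Notation innovation_law := (innovation_law bl br).
Local Notation jump_law := (jump_law bl br).
Local Notation step := (step p).

Let integral_uniform_if (c : R) (a b : \bar R) : 0 <= c <= 1 ->
  (0 <= a)%E -> (0 <= b)%E ->
  (\int[uniform_prob (@ltr01 R)]_u (if (u < c)%R then a else b) =
   c%:E * a + (1 - c)%:E * b)%E.
Proof.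
move=> /andP[c0 c1] a0 b0; pose U := uniform_prob (@ltr01 R).
have mA : measurable (`]-oo, c[%classic : set R) by [].
have UA : U `]-oo, c[%classic = c%:E.
  have -> : U `]-oo, c[%classic = (\int[U]_x (\1_(`]-oo, c[%classic) x)%:E)%E.
    by rewrite integral_indic// setIT.
  rewrite integral_uniform//; last first.
    exact/measurable_EFinP/measurable_indic.
  rewrite subr0 invr1 mul1e integral_indic//.
  rewrite (_ : _ `&` _ = `[0, c[%classic); last first.
    apply/seteqP; split => x /=; rewrite !in_itv/=.
      by move=> [xc /andP[-> _]].
    by move=> /andP[x0 xc]; rewrite x0 xc ltW// (lt_le_trans xc).
  by rewrite /= lebesgue_measure_itv/= lte_fin; case: ltgtP c0 => // [_ _|<- _]; rewrite ?sube0.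
have UCA : U (~` `]-oo, c[%classic) = (1 - c)%:E.
  by transitivity (1 - U `]-oo, c[%classic)%E; [exact: probability_setC|rewrite UA].
rewrite (eq_integral (fun u : M => (a * (\1_(`]-oo, c[%classic) u)%:E +
    b * (\1_(~` `]-oo, c[%classic) u)%:E)%E)); last first.
  move=> u _; rewrite !indicE in_setC mem_setE in_itv/=.
  by case: ifP => _; rewrite /= !(mule0, mule1, adde0, add0e).
have mI (B : set M) : measurable B ->
    measurable_fun [set: M] (fun u : M => (\1_B u : R)%:E).
  by move=> mB; exact/measurable_EFinP/measurable_indic.
have mA' := measurableC mA; have mI1 := mI _ mA; have mI2 := mI _ mA'.
have ge0 (B : set M) (c' : \bar R) : (0 <= c')%E ->
    forall x : M, [set: M] x -> (0 <= c' * (\1_B x : R)%:E)%E.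
  by move=> c'0 x _; rewrite mule_ge0// lee_fin.
have ge1 (B : set M) (x : M) : [set: M] x -> (0 <= (\1_B x : R)%:E)%E.
  by move=> _; rewrite lee_fin.
rewrite (ge0_integralD _ _ (ge0 _ _ a0) _ (ge0 _ _ b0))//; last 2 first.
- exact: emeasurable_funM.
- exact: emeasurable_funM.
rewrite (ge0_integralZl _ _ mI1 (ge1 _))// (ge0_integralZl _ _ mI2 (ge1 _))//.
rewrite !integral_indic ?setIT//.
rewrite [X in _ = (X + _)%E]muleC [X in _ = (_ + X)%E]muleC.
by congr (_ * _ + _ * _)%E; [exact: UA|exact: UCA].
Qed.

Local Notation K := (random_map_op innovation_law step).

Let m_left x : measurable_fun [set: M] (fun t => x - x * t : M).
Proof. by apply: measurable_funB => //; exact: measurable_funM. Qed.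

Let m_right x : measurable_fun [set: M] (fun t => x + (1 - x) * t : M).
Proof. by apply: measurable_funD => //; exact: measurable_funM. Qed.

(** Integrating out the uniform variable first leaves a mixture of a left and a
right jump. *)
Lemma step_opE (f : M -> \bar R) x : 0 <= x <= 1 ->
  measurable_fun setT f -> (forall y, 0 <= f y)%E ->
  (K f x = (p x)%:E * \int[bl]_t f (x - x * t)%R +
           (1 - p x)%:E * \int[br]_t f (x + (1 - x) * t)%R)%E.
Proof.
move=> x01 mf f0; have /andP[p0 p1] := p01 x01.
have mfs : measurable_fun [set: M * M * M] (fun v => f (step (x, v))).
  by apply: measurableT_comp => //; exact: (measurableT_comp (measurable_step mp)).
transitivity (\int[jump_law \x uniform_prob (@ltr01 R)]_v f (step (x, v)))%E.
  by [].
rewrite (@fubini_tonelli1 _ _ _ _ R jump_law (uniform_prob (@ltr01 R))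
  (fun v => f (step (x, v))) mfs (fun v => f0 _)).
rewrite /fubini_F (eq_integral (fun z : M * M => (p x)%:E * f (x - x * z.1)%R +
    (1 - p x)%:E * f (x + (1 - x) * z.2)%R)%E); last first.
  move=> z _; rewrite -integral_uniform_if ?f0 ?p0//.
  apply: eq_integral => u _.
  by rewrite /step chain_stepE//; case: ifP.
have mf1 : measurable_fun [set: M * M] (fun z => f (x - x * z.1)).
  by apply: (measurableT_comp mf); exact: (measurableT_comp (m_left x)).
have mf2 : measurable_fun [set: M * M] (fun z => f (x + (1 - x) * z.2)).
  by apply: (measurableT_comp mf); exact: (measurableT_comp (m_right x)).
rewrite ge0_integralD//; last 4 first.
- by move=> z _; rewrite mule_ge0// lee_fin.
- exact: emeasurable_funM.
- by move=> z _; rewrite mule_ge0// lee_fin subr_ge0.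
- exact: emeasurable_funM.
rewrite !ge0_integralZl//; last by rewrite lee_fin subr_ge0.
congr (_ * _ + _ * _)%E.
  rewrite (@fubini_tonelli1 _ _ _ _ R bl br _ mf1 (fun z => f0 _)).
  apply: eq_integral => t _; rewrite /fubini_F/=.
  by rewrite integral_cst// [X in (_ * X)%E]probability_setT mule1.
rewrite (@fubini_tonelli2 _ _ _ _ R bl br _ mf2 (fun z => f0 _)).
apply: eq_integral => t _; rewrite /fubini_G/=.
by rewrite integral_cst// [X in (_ * X)%E]probability_setT mule1.
Qed.

(** Substitute [y = x - x t] in the beta integral. *)
Lemma left_jump_density (f : R -> \bar R) x : 0 < x ->
  measurable_fun setT f -> (forall y, 0 <= f y)%E ->
  (\int[bl]_t f (x - x * t)%R =
   \int[mu]_(y in `]0%R, x[) (f y * (l * y `^ (l - 1) / x `^ l)%:E))%E.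
Proof.
move=> x0 mf f0.
have mfx : measurable_fun [set: M] (fun t : M => f (x - x * t)).
  by apply: (measurableT_comp mf); exact: m_left.
rewrite ge0_integral_beta1//.
pose q (y : R) := (f y * (l * y `^ (l - 1) / x `^ l)%:E)%E.
have mq : measurable_fun setT q.
  apply: emeasurable_funM => //; apply/measurable_EFinP.
  by do 2 apply: measurable_funM => //; exact: measurable_powR.
have q0 y : (0 <= q y)%E.
  by apply: mule_ge0 => //; rewrite lee_fin divr_ge0 ?powR_ge0// mulr_ge0 ?powR_ge0// ltW.
rewrite [LHS]integral_mkcond [RHS]integral_mkcond.
rewrite [RHS](@ge0_integral_affine _ x (- x) (q \_ `]0, x[)); first last.
- by move=> y; apply: erestrict_ge0 => {}y _; exact: q0.
- by apply/(measurable_restrictT q) => //; exact: measurable_funTS.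
- by rewrite oppr_eq0 gt_eqF.
rewrite normrN gtr0_norm// -ge0_integralZl//; first last.
- by rewrite lee_fin ltW.
- by move=> y _; apply: erestrict_ge0 => {}y _; exact: q0.
- apply: (measurableT_comp (f := q \_ `]0, x[)).
    by apply/(measurable_restrictT q) => //; exact: measurable_funTS.
  by apply: measurable_funD => //; exact: measurable_funM.
apply: eq_integral => t _; rewrite !patchE !mem_setE !in_itv/= mulNr.
rewrite subr_gt0 gtr_pMr// gtrBl pmulr_rgt0// andbC.
case: ifPn => [/andP[t1 t0]|_]; last by rewrite mule0.
rewrite /q muleCA -EFinM; congr (_ * _%:E)%E.
have t1' : 0 < 1 - t by rewrite subr_gt0.
rewrite (_ : x - x * t = x * (1 - t)); last by ring.
rewrite powRM ?ltW// [x `^ (l - 1)]powRB; last by apply/implyP => _; exact: lt0r_neq0.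
rewrite powRr1 ?ltW//; have := powR_gt0 l x0.
by move: (x `^ l) => k /lt0r_neq0 k0; field; rewrite k0 lt0r_neq0.
Qed.

(** Substitute [y = x + (1 - x) t]. *)
Lemma right_jump_density (f : R -> \bar R) x : x < 1 ->
  measurable_fun setT f -> (forall y, 0 <= f y)%E ->
  (\int[br]_t f (x + (1 - x) * t)%R =
   \int[mu]_(y in `]x, 1%R[) (f y * (r * (1 - y) `^ (r - 1) / (1 - x) `^ r)%:E))%E.
Proof.
move=> x1 mf f0; have x1' : 0 < 1 - x by rewrite subr_gt0.
have mfx : measurable_fun [set: M] (fun t : M => f (x + (1 - x) * t)).
  by apply: (measurableT_comp mf); exact: m_right.
rewrite ge0_integral_beta1//.
pose q (y : R) := (f y * (r * (1 - y) `^ (r - 1) / (1 - x) `^ r)%:E)%E.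
have mq : measurable_fun setT q.
  apply: emeasurable_funM => //; apply/measurable_EFinP.
  do 2 apply: measurable_funM => //.
  apply: (measurableT_comp (f := @powR R ^~ (r - 1))); first exact: measurable_powR.
  exact: measurable_funB.
have q0 y : (0 <= q y)%E.
  by apply: mule_ge0 => //; rewrite lee_fin divr_ge0 ?powR_ge0// mulr_ge0 ?powR_ge0// ltW.
rewrite [LHS]integral_mkcond [RHS]integral_mkcond.
rewrite [RHS](@ge0_integral_affine _ x (1 - x) (q \_ `]x, 1[)); first last.
- by move=> y; apply: erestrict_ge0 => {}y _; exact: q0.
- by apply/(measurable_restrictT q) => //; exact: measurable_funTS.
- exact: lt0r_neq0.
rewrite gtr0_norm// -ge0_integralZl//; first last.
- by rewrite lee_fin ltW.
- by move=> y _; apply: erestrict_ge0 => {}y _; exact: q0.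
- apply: (measurableT_comp (f := q \_ `]x, 1[)).
    by apply/(measurable_restrictT q) => //; exact: measurable_funTS.
  by apply: measurable_funD => //; exact: measurable_funM.
apply: eq_integral => t _; rewrite !patchE !mem_setE !in_itv/=.
rewrite ltrDl pmulr_rgt0// -ltrBrDl gtr_pMr//.
case: ifPn => [/andP[t0 t1]|_]; last by rewrite mule0.
rewrite /q muleCA -EFinM; congr (_ * _%:E)%E.
have t1' : 0 < 1 - t by rewrite subr_gt0.
rewrite (_ : 1 - (x + (1 - x) * t) = (1 - x) * (1 - t)); last by ring.
rewrite powRM ?ltW// [(1 - x) `^ (r - 1)]powRB; last by apply/implyP => _; exact: lt0r_neq0.
rewrite powRr1 ?ltW//; have := powR_gt0 r x1'.
by move: ((1 - x) `^ r) => k /lt0r_neq0 k0; field; rewrite k0 lt0r_neq0.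
Qed.

Lemma step_op_density (f : R -> \bar R) x : 0 < x < 1 ->
  measurable_fun setT f -> (forall y, 0 <= f y)%E ->
  (K f x =
   (p x)%:E * \int[mu]_(y in `]0%R, x[) (f y * (l * y `^ (l - 1) / x `^ l)%:E) +
   (1 - p x)%:E *
     \int[mu]_(y in `]x, 1%R[) (f y * (r * (1 - y) `^ (r - 1) / (1 - x) `^ r)%:E))%E.
Proof.
move=> /andP[x0 x1] mf f0; rewrite step_opE ?ltW//.
by congr (_ * _ + _ * _)%E; [exact: left_jump_density|exact: right_jump_density].
Qed.

Lemma step_in01 x : 0 <= x <= 1 ->
  {ae innovation_law, forall v, `[(0 : R), 1]%classic (step (x, v))}.
Proof.
move=> x01; have /andP[x0 x1] := x01; have /andP[p0 p1] := p01 x01.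
pose A : set M := ~` `[(0 : R), 1]%classic.
have mA : measurable A by exact: measurableC.
exists ((fun v => step (x, v)) @^-1` A); split => //.
  rewrite -[X in measurable X]setTI.
  by apply: (measurableT_comp (measurable_step mp) (measurable_pair1 x)).
have mf : measurable_fun setT (EFin \o (\1_A : M -> R)).
  exact/measurable_EFinP/measurable_indic.
have f0 y : (0 <= (EFin \o (\1_A : M -> R)) y)%E by rewrite lee_fin.
rewrite -[LHS](random_map_op_indic _ (measurable_step mp))//.
rewrite step_opE//.
have zero y : 0 <= y <= 1 -> \1_A y = 0 :> R.
  by move=> y01; rewrite indicE memNset//= in_itv/= y01; exact.
have zl : (\int[bl]_t (EFin \o (\1_A : M -> R)) (x - x * t)%R = 0)%E.
  rewrite ge0_integral_beta1//; last by apply: (measurableT_comp mf); exact: m_left.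
  apply: integral0_eq => t; rewrite /= in_itv/= => /andP[t0 t1].
  by rewrite zero ?mul0e//; nra.
have zr : (\int[br]_t (EFin \o (\1_A : M -> R)) (x + (1 - x) * t)%R = 0)%E.
  rewrite ge0_integral_beta1//; last by apply: (measurableT_comp mf); exact: m_right.
  apply: integral0_eq => t; rewrite /= in_itv/= => /andP[t0 t1].
  by rewrite zero ?mul0e//; nra.
by rewrite [X in (_ * X + _)%E]zl [X in (_ + _ * X)%E]zr !mule0 adde0.
Qed.

Variables delta eps : R.
Hypothesis hdelta : 0 < delta < 1 / 2.
Hypothesis heps : 0 < eps <= 1 / 2.
Hypothesis p_left : forall x, 0 <= x <= delta -> p x <= 1 - eps.
Hypothesis p_right : forall x, 1 - delta <= x <= 1 -> eps <= p x.

Local Notation eta := (delta / 2).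

(** A common lower bound of the two jump densities away from the endpoint that they
move to, uniform in the starting point. *)
Definition density_floor := Num.min (l * eta `^ l) (r * eta `^ r).

Local Notation m := density_floor.

Lemma density_floor_gt0 : 0 < m.
Proof.
have eta0 : 0 < eta by rewrite divr_gt0//; case/andP: hdelta.
by rewrite lt_min !mulr_gt0 ?powR_gt0.
Qed.

(** The factor [y^(a-1)] may blow up or vanish at 0 depending on [a]; since
[y <= 1], it always dominates [y^a]. *)
Let powR_ge_eta a y : 0 < a -> eta <= y -> y <= 1 -> eta `^ a <= y `^ (a - 1).
Proof.
move=> a0 ey y1; have eta0 : 0 < eta by rewrite divr_gt0//; case/andP: hdelta.
have y0 := lt_le_trans eta0 ey.
apply: (@le_trans _ _ (y `^ a)); first by rewrite ge0_ler_powR ?nnegrE// ltW.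
by rewrite ger_powR ?y0// gerBl.
Qed.

Lemma step_op_left_ge (f : R -> \bar R) x a b : 0 < x <= 1 ->
  measurable_fun setT f -> (forall y, 0 <= f y)%E ->
  eps <= p x -> eta <= a -> b <= x ->
  ((eps * m)%:E * \int[mu]_(y in `]a, b[) f y <= K f x)%E.
Proof.
move=> /andP[x0 x1] mf f0 epx ea bx.
have eta0 : 0 < eta by rewrite divr_gt0//; case/andP: hdelta.
have m0 := density_floor_gt0.
have x01 : 0 <= x <= 1 by rewrite ltW.
have /andP[p0 p1] := p01 x01.
rewrite step_opE//; apply: (le_trans _ (leeDl _ _)); last first.
  apply: mule_ge0; first by rewrite lee_fin subr_ge0.
  by apply: integral_ge0 => t _; exact: f0.
rewrite [X in (_ <= _ * X)%E](left_jump_density x0 mf f0).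
have [e0 _] := andP heps.
rewrite EFinM -muleA; apply: lee_pmul; rewrite ?lee_fin//; first exact: ltW.
  by apply: mule_ge0; [rewrite lee_fin ltW|exact: integral_ge0].
rewrite -ge0_integralZl//; last 2 first.
- exact: measurable_funTS.
- by rewrite lee_fin ltW.
have mq : measurable_fun setT (fun y => f y * (l * y `^ (l - 1) / x `^ l)%:E)%E.
  apply: emeasurable_funM => //; apply/measurable_EFinP.
  by do 2 apply: measurable_funM => //; exact: measurable_powR.
have q0 y : (0 <= f y * (l * y `^ (l - 1) / x `^ l)%:E)%E.
  by apply: mule_ge0 => //; rewrite lee_fin divr_ge0 ?powR_ge0// mulr_ge0 ?powR_ge0// ltW.
apply: (@le_trans _ _ (\int[mu]_(y in `]a, b[) (f y * (l * y `^ (l - 1) / x `^ l)%:E))%E).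
  apply: ge0_le_integral => //.
  - by move=> y _; apply: mule_ge0 => //; rewrite lee_fin ltW.
  - by apply: emeasurable_funM => //; exact: measurable_funTS.
  - exact: measurable_funTS.
  - move=> y; rewrite /= in_itv/= => /andP[ay yb]; rewrite muleC lee_wpmul2l// lee_fin.
    rewrite (@le_trans _ _ (l * eta `^ l))// ?ge_min ?lexx// -[leLHS]mulr1.
    apply: ler_pM => //.
    + by rewrite mulr_ge0 ?powR_ge0// ltW.
    + rewrite ler_pM2l// powR_ge_eta// ?(le_trans ea) ?ltW//.
      by rewrite (lt_le_trans yb)// (le_trans bx).
    + rewrite invf_ge1 ?powR_gt0// -(powRr0 x) ger_powR ?x0//; exact: ltW.
apply: ge0_subset_integral => //; first exact: measurable_funTS.
by apply: subset_itv; rewrite bnd_simp// (le_trans _ ea)// ltW.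
Qed.

Lemma step_op_right_ge (f : R -> \bar R) x a b : 0 <= x < 1 ->
  measurable_fun setT f -> (forall y, 0 <= f y)%E ->
  p x <= 1 - eps -> x <= a -> b <= 1 - eta ->
  ((eps * m)%:E * \int[mu]_(y in `]a, b[) f y <= K f x)%E.
Proof.
move=> /andP[x0 x1] mf f0 epx xa be.
have eta0 : 0 < eta by rewrite divr_gt0//; case/andP: hdelta.
have m0 := density_floor_gt0.
have x01 : 0 <= x <= 1 by rewrite x0 ltW.
have /andP[p0 p1] := p01 x01.
have x1' : 0 < 1 - x by rewrite subr_gt0.
rewrite step_opE//; apply: (le_trans _ (leeDr _ _)); last first.
  apply: mule_ge0; first by rewrite lee_fin.
  by apply: integral_ge0 => t _; exact: f0.
rewrite [X in (_ <= _ * X)%E](right_jump_density x1 mf f0).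
have [e0 _] := andP heps.
rewrite EFinM -muleA; apply: lee_pmul; rewrite ?lee_fin//; first exact: ltW.
  by apply: mule_ge0; [rewrite lee_fin ltW|exact: integral_ge0].
  by rewrite lerBrDr -lerBrDl.
rewrite -ge0_integralZl//; last 2 first.
- exact: measurable_funTS.
- by rewrite lee_fin ltW.
have mq : measurable_fun setT
    (fun y => f y * (r * (1 - y) `^ (r - 1) / (1 - x) `^ r)%:E)%E.
  apply: emeasurable_funM => //; apply/measurable_EFinP.
  do 2 apply: measurable_funM => //.
  apply: (measurableT_comp (f := @powR R ^~ (r - 1))); first exact: measurable_powR.
  exact: measurable_funB.
have q0 y : (0 <= f y * (r * (1 - y) `^ (r - 1) / (1 - x) `^ r)%:E)%E.
  by apply: mule_ge0 => //; rewrite lee_fin divr_ge0 ?powR_ge0// mulr_ge0 ?powR_ge0// ltW.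
apply: (@le_trans _ _
    (\int[mu]_(y in `]a, b[) (f y * (r * (1 - y) `^ (r - 1) / (1 - x) `^ r)%:E))%E).
  apply: ge0_le_integral => //.
  - by move=> y _; apply: mule_ge0 => //; rewrite lee_fin ltW.
  - by apply: emeasurable_funM => //; exact: measurable_funTS.
  - exact: measurable_funTS.
  - move=> y; rewrite /= in_itv/= => /andP[ay yb]; rewrite muleC lee_wpmul2l// lee_fin.
    rewrite (@le_trans _ _ (r * eta `^ r))// ?ge_min ?lexx ?orbT// -[leLHS]mulr1.
    apply: ler_pM => //.
    + by rewrite mulr_ge0 ?powR_ge0// ltW.
    + rewrite ler_pM2l// powR_ge_eta//; lra.
    + rewrite invf_ge1 ?powR_gt0// -[leRHS](powRr0 (1 - x)) ger_powR ?x1'//; first by rewrite gerBl.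
      exact: ltW.
apply: ge0_subset_integral => //; first exact: measurable_funTS.
by apply: subset_itv; rewrite bnd_simp// (le_trans be)// gerBl ltW.
Qed.

Let const_le_integral (g : R -> \bar R) (k : \bar R) (a b : R) : a <= b ->
  measurable_fun setT g -> (forall y, 0 <= g y)%E -> (0 <= k)%E ->
  (forall y : R, (a < y < b)%R -> k <= g y)%E ->
  (k * (b - a)%:E <= \int[mu]_(y in `]a, b[) g y)%E.
Proof.
move=> ab mg g0 k0 kg.
have -> : (k * (b - a)%:E = \int[mu]_(y in `]a, b[) (cst k) y)%E.
  rewrite integral_cst//= lebesgue_measure_itv/= lte_fin.
  by case: ltgtP ab => // -> _; rewrite subrr.
by apply: ge0_le_integral => //; exact: measurable_funTS.
Qed.

(** From both end zones [[0, delta]] and [[1 - delta, 1]] the middle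
[(delta, 1 - delta)] is reached with density at least [eps * m].  From any point,
the first step enters one of the strips [(eta, delta)] and [(1 - delta, 1 - eta)],
of width [eta], with density at least [eps * m]: the far one from an end zone,
and from the middle the one on the side that [p] favours. *)
Lemma two_step_minorization (f : R -> \bar R) x : 0 <= x <= 1 ->
  measurable_fun setT f -> (forall y, 0 <= f y)%E ->
  (((eps * m) ^+ 2 * eta)%:E * \int[mu]_(y in `]delta, (1 - delta)%R[) f y <=
   K (K f) x)%E.
Proof.
move=> x01 mf f0; have [x0 x1] := andP x01; have [d0 d1] := andP hdelta.
have [e0 e1] := andP heps.
have eta0 : 0 < eta by rewrite divr_gt0.
have m0 := density_floor_gt0.
have etad : delta - eta = eta by field.
set J := (\int[mu]_(y in _) _)%E.
have J0 : (0 <= J)%E by exact: integral_ge0.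
have mK : measurable_fun setT (K f) by exact: measurable_random_map_op (measurable_step mp) _ _ _.
have K0 y : (0 <= K f y)%E by exact: random_map_op_ge0.
have k0 : (0 <= (eps * m)%:E * J)%E.
  by apply: mule_ge0 => //; rewrite lee_fin mulr_ge0// ltW.
have Kl y : 0 <= y <= delta -> ((eps * m)%:E * J <= K f y)%E.
  move=> /andP[y0 yd]; apply: step_op_right_ge => //; [|by rewrite p_left ?y0|]; lra.
have Kr y : 1 - delta <= y <= 1 -> ((eps * m)%:E * J <= K f y)%E.
  move=> /andP[dy y1]; apply: step_op_left_ge => //; [|by rewrite p_right ?dy|]; lra.
have -> : (((eps * m) ^+ 2 * eta)%:E * J = (eps * m)%:E * ((eps * m)%:E * J * eta%:E))%E.
  rewrite expr2 EFinM (EFinM (eps * m)) -!muleA; congr (_ * (_ * _))%E.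
  exact: muleC.
have em0 : (0 <= (eps * m)%:E)%E by rewrite lee_fin mulr_ge0// ltW.
have goL : eps <= p x -> delta <= x ->
    ((eps * m)%:E * ((eps * m)%:E * J * eta%:E) <= K (K f) x)%E.
  move=> epx dx; apply: (@le_trans _ _ ((eps * m)%:E * \int[mu]_(y in `]eta, delta[) K f y)%E).
    apply: lee_wpmul2l => //; rewrite -{1}etad; apply: const_le_integral => //; first lra.
    by move=> y /andP[ey yd]; apply: Kl; rewrite !ltW// (lt_trans eta0).
  by apply: step_op_left_ge => //; rewrite (lt_le_trans d0).
have goR : p x <= 1 - eps -> x <= 1 - delta ->
    ((eps * m)%:E * ((eps * m)%:E * J * eta%:E) <= K (K f) x)%E.
  move=> epx dx; apply: (@le_trans _ _
      ((eps * m)%:E * \int[mu]_(y in `](1 - delta)%R, (1 - eta)%R[) K f y)%E).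
    apply: lee_wpmul2l => //; rewrite -{1}(_ : (1 - eta) - (1 - delta) = eta); last by field.
    apply: const_le_integral => //; first lra.
    by move=> y /andP[dy yd]; apply: Kr; rewrite ltW//= ltW// (lt_trans yd)// gtrBl.
  by apply: step_op_right_ge => //; rewrite x0/=; lra.
have [xd|dx] := leP x delta.
  by apply: goR; [rewrite p_left ?x0|lra].
have [xd|dx'] := leP (1 - delta) x.
  by apply: goL; [rewrite p_right ?xd|exact: ltW].
have [p2|p2] := leP (1 / 2) (p x).
  by apply: goL; lra.
by apply: goR; lra.
Qed.

End transition_operator.

(** * Invariance of the weight *)

Section invariance.
Context {R : realType}.
Local Notation mu := (@lebesgue_measure R).
Variables (l r : R) (p : R -> R).
Hypotheses (hl : 0 < l) (hr : 0 < r).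
Hypothesis p01 : forall x, 0 <= x <= 1 -> 0 <= p x <= 1.
Hypothesis mp : measurable_fun `[(0 : R), 1] p.
Variables delta eps : R.
Hypothesis hdelta : 0 < delta < 1 / 2.
Hypothesis heps : 0 < eps <= 1.
Hypothesis p_left : forall x, 0 <= x <= delta -> p x <= 1 - eps.
Hypothesis p_right : forall x, 1 - delta <= x <= 1 -> eps <= p x.

Local Notation K :=
  (random_map_op (innovation_law (beta1_law hl) (beta1_law hr)) (step p)).
Local Notation w := (weight l r p).
Local Notation h := (hazard l r).
Local Notation E x := (expR (- left_clock l r p x)).
Local Notation G x := (expR (log_weight l r x - left_clock l r p x)).

Let measurable_powR_onem (a : R) : measurable_fun setT (fun y : R => (1 - y) `^ a).
Proof.
apply: (measurableT_comp (f := @powR R ^~ a)); first exact: measurable_powR.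
exact: measurable_funB.
Qed.

(** Both halves of the transition operator are integrals over a triangle with an
integrand that separates; exchanging the order turns them into a tail of the
left flow and a head of the right flow. *)
Lemma weight_invariant (f : R -> \bar R) :
  measurable_fun setT f -> (forall y, 0 <= f y)%E ->
  (\int[mu]_(x in `]0%R, 1%R[) (K f x * (w x)%:E) =
   \int[mu]_(x in `]0%R, 1%R[) (f x * (w x)%:E))%E.
Proof.
move=> mf f0.
pose I01 : set R := `]0, 1[%classic.
have mI : measurable I01 by exact: measurable_itv.
pose u1 := (fun x => (p x * w x / x `^ l)%:E) \_ I01.
pose u2 := (fun x => ((1 - p x) * w x / (1 - x) `^ r)%:E) \_ I01.
pose v1 y := (f y * (l * y `^ (l - 1))%:E)%E.
pose v2 y := (f y * (r * (1 - y) `^ (r - 1))%:E)%E.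
have w0 x : 0 < x < 1 -> 0 < w x by move=> x01; exact: weight_gt0.
have p01' x : 0 < x < 1 -> 0 <= p x <= 1 by move=> /andP[x0 x1]; apply: p01; rewrite !ltW.
have mp' : measurable_fun I01 p.
  apply: measurable_funS mp => // x; rewrite /I01/= !in_itv/= => /andP[? ?].
  by rewrite !ltW.
have mw : measurable_fun I01 w by exact: measurable_weight.
have u10 x : (0 <= u1 x)%E.
  apply: erestrict_ge0 => {}x; rewrite /I01/= in_itv/= => x01; have /andP[a b] := p01' _ x01.
  rewrite lee_fin divr_ge0 ?powR_ge0//; apply: mulr_ge0 => //; exact/ltW/w0.
have u20 x : (0 <= u2 x)%E.
  apply: erestrict_ge0 => {}x; rewrite /I01/= in_itv/= => x01; have /andP[a b] := p01' _ x01.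
  rewrite lee_fin divr_ge0 ?powR_ge0//; apply: mulr_ge0; [by rewrite subr_ge0|exact/ltW/w0].
have v10 x : (0 <= v1 x)%E.
  by apply: mule_ge0 => //; rewrite lee_fin mulr_ge0 ?powR_ge0// ltW.
have v20 x : (0 <= v2 x)%E.
  by apply: mule_ge0 => //; rewrite lee_fin mulr_ge0 ?powR_ge0// ltW.
have mu1 : measurable_fun setT u1.
  apply/(measurable_restrictT (fun x => (p x * w x / x `^ l)%:E)) => //.
  apply/measurable_EFinP; apply: measurable_funM; first exact: measurable_funM.
  apply: measurable_funTS; apply: (measurableT_comp (@measurable_invr R)).
  exact: measurable_powR.
have mu2 : measurable_fun setT u2.
  apply/(measurable_restrictT (fun x => ((1 - p x) * w x / (1 - x) `^ r)%:E)) => //.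
  apply/measurable_EFinP; apply: measurable_funM.
    by apply: measurable_funM => //; exact: measurable_funB.
  apply: measurable_funTS; apply: (measurableT_comp (@measurable_invr R)).
  exact: measurable_powR_onem.
have mv1 : measurable_fun setT v1.
  apply: emeasurable_funM => //; apply/measurable_EFinP.
  by apply: measurable_funM => //; exact: measurable_powR.
have mv2 : measurable_fun setT v2.
  apply: emeasurable_funM => //; apply/measurable_EFinP.
  by apply: measurable_funM => //; exact: measurable_powR_onem.
have mS (v : R -> \bar R) : measurable_fun setT v ->
    forall A : set R, measurable A -> measurable_fun A v.
  by move=> mv A mA; exact: measurable_funTS.
have i1 x : 0 < x < 1 -> (\int[mu]_(y in `]x, 1%R[) u1 y = (E x)%:E)%E.
  move=> /[dup] x01 /andP[x0 x1].
  rewrite -(integral_left_tail hl hr p01 mp hdelta heps p_right x01).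
  apply: eq_integral => y; rewrite inE/= in_itv/= => /andP[xy y1].
  have y01 : 0 < y < 1 by rewrite (lt_trans x0).
  by rewrite /u1 patchE mem_setE in_itv/= y01 left_flow_weight.
have i2 x : 0 < x < 1 -> (\int[mu]_(y in `]0%R, x[) u2 y = (G x)%:E)%E.
  move=> /[dup] x01 /andP[x0 x1].
  rewrite -(integral_right_head hl hr p01 mp hdelta heps p_left x01).
  apply: eq_integral => y; rewrite inE/= in_itv/= => /andP[y0 yx].
  have y01 : 0 < y < 1 by rewrite y0 (lt_trans yx).
  by rewrite /u2 patchE mem_setE in_itv/= y01 right_flow_weight.
have mF : measurable_fun I01 (fun x => (u1 x * \int[mu]_(y in `]0%R, x[) v1 y)%E).
  by apply: measurable_funTS; apply: emeasurable_funM => //; exact: measurable_integral_itv_left.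
have mG : measurable_fun I01 (fun x => (u2 x * \int[mu]_(y in `]x, 1%R[) v2 y)%E).
  by apply: measurable_funTS; apply: emeasurable_funM => //; exact: measurable_integral_itv_right.
transitivity (\int[mu]_(x in I01) (u1 x * \int[mu]_(y in `]0%R, x[) v1 y +
    u2 x * \int[mu]_(y in `]x, 1%R[) v2 y))%E.
  apply: eq_integral => x xI; move: (set_mem xI); rewrite /I01/= in_itv/= => x01.
  have /andP[x0 x1] := x01; have /andP[p0 p1] := p01' _ x01; have wx := ltW (w0 _ x01).
  have xl0 : (0 <= ((x `^ l)^-1)%:E :> \bar R)%E by rewrite lee_fin invr_ge0 powR_ge0.
  have xr0 : (0 <= (((1 - x) `^ r)^-1)%:E :> \bar R)%E by rewrite lee_fin invr_ge0 powR_ge0.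
  have A1 : (\int[mu]_(y in `]0%R, x[) (f y * (l * y `^ (l - 1) / x `^ l)%:E) =
      (\int[mu]_(y in `]0%R, x[) v1 y) * ((x `^ l)^-1)%:E)%E.
    rewrite -ge0_integralZr//; last exact: mS.
    by apply: eq_integral => y _; rewrite /v1 EFinM muleA.
  have A2 : (\int[mu]_(y in `]x, 1%R[) (f y * (r * (1 - y) `^ (r - 1) / (1 - x) `^ r)%:E) =
      (\int[mu]_(y in `]x, 1%R[) v2 y) * (((1 - x) `^ r)^-1)%:E)%E.
    rewrite -ge0_integralZr//; last exact: mS.
    by apply: eq_integral => y _; rewrite /v2 EFinM muleA.
  rewrite step_op_density// A1 A2 ge0_muleDl; last 2 first.
  - by apply: mule_ge0; [rewrite lee_fin|apply: mule_ge0 => //; exact: integral_ge0].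
  - by apply: mule_ge0; [rewrite lee_fin subr_ge0|apply: mule_ge0 => //; exact: integral_ge0].
  rewrite /u1 /u2 !patchE !mem_setE !in_itv/= x01.
  congr (_ + _)%E; rewrite muleC.
    rewrite (EFinM (p x * w x)) (EFinM (p x)).
    by rewrite [(_ * (x `^ l)^-1%:E)%E]muleC !muleA [((w x)%:E * _)%E]muleC.
  rewrite (EFinM ((1 - p x) * w x)) (EFinM (1 - p x)).
  by rewrite [(_ * ((1 - x) `^ r)^-1%:E)%E]muleC !muleA [((w x)%:E * _)%E]muleC.
have n1 x : I01 x -> (0 <= u1 x * \int[mu]_(y in `]0%R, x[) v1 y)%E.
  by move=> _; apply: mule_ge0 => //; exact: integral_ge0.
have n2 x : I01 x -> (0 <= u2 x * \int[mu]_(y in `]x, 1%R[) v2 y)%E.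
  by move=> _; apply: mule_ge0 => //; exact: integral_ge0.
rewrite (ge0_integralD mu mI n1 mF n2 mG).
transitivity (\int[mu]_(y in `]0%R, 1%R[) (v1 y * \int[mu]_(x in `]y, 1%R[) u1 x) +
    \int[mu]_(y in `]0%R, 1%R[) (v2 y * \int[mu]_(x in `]0%R, y[) u2 x))%E.
  congr (_ + _)%E; first exact: tonelli_triangle mu1 mv1 u10 v10.
  exact: esym (tonelli_triangle 0 1 mv2 mu2 v20 u20).
rewrite -ge0_integralD//; first last.
- apply: measurable_funTS; apply: emeasurable_funM => //; exact: measurable_integral_itv_left.
- by move=> x _; apply: mule_ge0 => //; exact: integral_ge0.
- apply: measurable_funTS; apply: emeasurable_funM => //; exact: measurable_integral_itv_right.
- by move=> x _; apply: mule_ge0 => //; exact: integral_ge0.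
apply: eq_integral => x; rewrite inE/= in_itv/= => x01.
have /andP[x0 x1] := x01.
rewrite i1// i2// /v1 /v2 -!muleA -ge0_muleDr; last 2 first.
- by apply: mule_ge0; rewrite lee_fin ?expR_ge0// mulr_ge0 ?powR_ge0// ltW.
- by apply: mule_ge0; rewrite lee_fin ?expR_ge0// mulr_ge0 ?powR_ge0// ltW.
by congr (_ * _)%E; rewrite -!EFinM -EFinD -weight_balance.
Qed.

End invariance.

(** * Evolution of the law of the chain *)

Section pair_law.
Local Open Scope ereal_scope.
Context d (Omega : measurableType d) (R : realType) (P : probability Omega R).
Context d1 d2 (T1 : measurableType d1) (T2 : measurableType d2).
Variables (X : Omega -> T1) (Y : Omega -> T2) (F : set Omega).
Hypotheses (mX : measurable_fun setT X) (mY : measurable_fun setT Y).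
Hypothesis mF : measurable F.
Variables (m1 : probability T1 R) (m2 : probability T2 R).
Hypothesis XYE : forall A1 A2, measurable A1 -> measurable A2 ->
  P (X @^-1` A1 `&` Y @^-1` A2 `&` F) = m1 A1 * m2 A2 * P F.

(** A joint law given on rectangles is a product law.  The event [F] carries along
the remaining innovations; dividing by its probability reduces to the
uniqueness of product measures. *)
Lemma pair_law C : measurable C ->
  P ((fun w => (X w, Y w)) @^-1` C `&` F) = (m1 \x m2) C * P F.
Proof.
move=> mC; have mXY : measurable_fun setT (fun w => (X w, Y w)).
  exact: measurable_fun_pair.
have mpre (B : set (T1 * T2)) : measurable B -> measurable ((fun w => (X w, Y w)) @^-1` B).
  by move=> mB; rewrite -[X in measurable X]setTI; exact: mXY.
have [PF0|PF0] := eqVneq (P F) 0.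
  rewrite PF0 mule0; apply: (subset_measure0 _ mF _ PF0) => //.
  exact: measurableI (mpre _ mC) mF.
pose c := fine (P F).
have cE : P F = c%:E by rewrite /c fineK// fin_num_measure.
have c0 : (0 < c)%R by rewrite -lte_fin -cE lt0e PF0 measure_ge0.
pose XY : {mfun Omega >-> (T1 * T2)%type} :=
  HB.pack (fun w => (X w, Y w)) (isMeasurableFun.Build _ _ _ _ _ mXY).
pose k : {nonneg R} := NngNum (ltW (etrans (invr_gt0 c) c0)).
have := @product_measure_unique _ _ T1 T2 R m1 m2
  (mscale k (pushforward (mrestr P mF) XY)).
move=> -> //.
  rewrite /mscale/= /pushforward /mrestr/= cE muleC muleA -EFinM divff ?gt_eqF//.
  by rewrite mul1e.
move=> A1 A2 mA1 mA2; rewrite /mscale/= /pushforward /mrestr/=.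
transitivity (c^-1%:E * P (X @^-1` A1 `&` Y @^-1` A2 `&` F)); first by [].
by rewrite XYE// cE muleC -muleA -EFinM divff ?gt_eqF// mule1.
Qed.

End pair_law.

Section chain_law.
Local Open Scope ereal_scope.
Context {R : realType}.
Local Notation M := (measurableTypeR R).
Variable p : R -> R.
Hypothesis mp : measurable_fun `[(0%R : R), 1%R] p.
Context d (Omega : measurableType d) (P : probability Omega R).
Variables L Rr U : nat -> {RV P >-> R}.
Hypothesis hind : mutually_independent (innovations L Rr U).
Variables bl br : probability M R.
Hypothesis blE : forall n A, measurable A -> distribution P (L n) A = bl A.
Hypothesis brE : forall n A, measurable A -> distribution P (Rr n) A = br A.
Hypothesis uE : forall n A, measurable A ->
  distribution P (U n) A = uniform_prob (@ltr01 R) A.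
Variable x0 : R.

Local Notation Z n := (chain p L Rr U x0 n : Omega -> M).

Let Y := innovations L Rr U.

Let time (i : nat + nat + nat) : nat :=
  match i with inl (inl n) => n | inl (inr n) => n | inr n => n end.

Let V n (w : Omega) : M * M * M := ((L n w, Rr n w), U n w).

Let mL n : measurable_fun [set: Omega] (L n : Omega -> M).
Proof. exact: (@measurable_funPT _ _ _ _ (L n)). Qed.

Let mR n : measurable_fun [set: Omega] (Rr n : Omega -> M).
Proof. exact: (@measurable_funPT _ _ _ _ (Rr n)). Qed.

Let mU n : measurable_fun [set: Omega] (U n : Omega -> M).
Proof. exact: (@measurable_funPT _ _ _ _ (U n)). Qed.

Let mV n : measurable_fun [set: Omega] (V n).
Proof. by apply: measurable_fun_pair => //; exact: measurable_fun_pair. Qed.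

Let chainS n : Z n.+1 = fun w => step p (Z n w, V n w).
Proof. by []. Qed.

Lemma measurable_chain n : measurable_fun [set: Omega] (Z n).
Proof.
elim: n => [|n IHn]; first exact: measurable_cst.
rewrite chainS; apply: (measurableT_comp (measurable_step mp)).
exact: measurable_fun_pair.
Qed.

Let mpre d' (T : measurableType d') (f : Omega -> T) A :
  measurable_fun setT f -> measurable A -> measurable (f @^-1` A).
Proof. by move=> mf mA; rewrite -[X in measurable X]setTI; exact: mf. Qed.

Definition innovation_event (J : seq (nat + nat + nat)) (A : nat + nat + nat -> set R) :=
  \bigcap_(i in [set` J]) (Y i @^-1` A i).

Let mY i : measurable_fun [set: Omega] (Y i : Omega -> M).
Proof. exact: (@measurable_funPT _ _ _ _ (Y i)). Qed.

Let event_cons i J A :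
  innovation_event (i :: J) A = Y i @^-1` A i `&` innovation_event J A.
Proof. by rewrite /innovation_event !bigcap_seq big_cons. Qed.

Let event_measurable J A : (forall i, i \in J -> measurable (A i)) ->
  measurable (innovation_event J A).
Proof.
move=> mA; apply: fin_bigcap_measurable; first exact: finite_seq.
by move=> i iJ; apply: mpre => //; exact: mA.
Qed.

(** The state at time [n] is independent of the innovations not yet used.  Only
finitely many of them are named at once, which is the form in which mutual
independence is given. *)
Let indep_future n := forall J A B, uniq J -> all (fun i => n <= time i)%N J ->
  (forall i, i \in J -> measurable (A i)) -> measurable B ->
  P (Z n @^-1` B `&` innovation_event J A) =
  P (Z n @^-1` B) * P (innovation_event J A).

(** The state at time [n], the next innovations and any later ones have a product
law: this is [indep_future] for events listing the three next innovations,
extended from rectangles one coordinate at a time. *)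
Let joint_law n : indep_future n -> forall J A, uniq J ->
  all (fun i => n < time i)%N J -> (forall i, i \in J -> measurable (A i)) ->
  forall C, measurable C ->
  P ((fun w => (Z n w, V n w)) @^-1` C `&` innovation_event J A) =
  (pushforward P (Z n) \x innovation_law bl br) C * P (innovation_event J A).
Proof.
move=> IHn J A uJ nJ mA; set F := innovation_event J A.
have mF : measurable F by exact: event_measurable.
pose Zn : {mfun Omega >-> M} :=
  HB.pack (Z n) (isMeasurableFun.Build _ _ _ _ _ (measurable_chain n)).
pose m := distribution P Zn.
have rect B0 B1 B2 B3 : measurable B0 -> measurable B1 -> measurable B2 -> measurable B3 ->
    P (Z n @^-1` B0 `&` (L n @^-1` B1 `&` (Rr n @^-1` B2 `&` (U n @^-1` B3 `&` F)))) =
    m B0 * (bl B1 * (br B2 * (uniform_prob (@ltr01 R) B3 * P F))).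
  move=> mB0 mB1 mB2 mB3.
  pose iL : nat + nat + nat := inl (inl n).
  pose iR : nat + nat + nat := inl (inr n).
  pose iU : nat + nat + nat := inr n.
  pose A' i := if i == iL then B1 else if i == iR then B2 else if i == iU then B3 else A i.
  have notJ i : time i = n -> i \notin J.
    by move=> tin; apply/negP => /(allP nJ); rewrite tin ltnn.
  have A'J i : i \in J -> A' i = A i.
    move=> iJ; rewrite /A'; case: eqP => [iE|_].
      by move: iJ; rewrite iE (negbTE (notJ iL erefl)).
    case: eqP => [iE|_].
      by move: iJ; rewrite iE (negbTE (notJ iR erefl)).
    by case: eqP => // iE; move: iJ; rewrite iE (negbTE (notJ iU erefl)).
  have A'L : A' iL = B1 by rewrite /A' eqxx.
  have A'R : A' iR = B2 by rewrite /A' eqxx.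
  have A'U : A' iU = B3 by rewrite /A' eqxx.
  have FE : F = innovation_event J A'.
    by apply: eq_bigcapr => i iJ; rewrite A'J.
  have uJ' : uniq [:: iL, iR, iU & J].
    by rewrite /= !inE !negb_or/= !notJ.
  have nJ' : all (fun i => n <= time i)%N [:: iL, iR, iU & J].
    by rewrite /= leqnn/=; apply: sub_all nJ => i; exact: ltnW.
  have mA'J i : i \in J -> measurable (A' i) by move=> iJ; rewrite A'J//; exact: mA.
  have mA' i : i \in [:: iL, iR, iU & J] -> measurable (A' i).
    rewrite !inE => /or4P[/eqP->|/eqP->|/eqP->|/mA'J//].
    - by rewrite A'L.
    - by rewrite A'R.
    - by rewrite A'U.
  have -> : L n @^-1` B1 `&` (Rr n @^-1` B2 `&` (U n @^-1` B3 `&` F)) =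
      innovation_event [:: iL, iR, iU & J] A'.
    by rewrite !event_cons A'L A'R A'U -FE.
  rewrite IHn//; congr (_ * _).
  rewrite [LHS](hind uJ' mA') !big_cons FE [X in _ = _ * (_ * (_ * X))](hind uJ mA'J).
  rewrite A'L A'R A'U.
  by congr (_ * (_ * (_ * _))); [exact: blE|exact: brE|exact: uE].
have rect3 B0 B3 : measurable B0 -> measurable B3 ->
    P (Z n @^-1` B0 `&` (U n @^-1` B3 `&` F)) =
    m B0 * (uniform_prob (@ltr01 R) B3 * P F).
  move=> mB0 mB3; have := rect B0 setT setT B3 mB0 measurableT measurableT mB3.
  by rewrite !preimage_setT !setTI !probability_setT !mul1e.
have rect4 B0 : measurable B0 -> P (Z n @^-1` B0 `&` F) = m B0 * P F.
  move=> mB0; have := rect3 B0 setT mB0 measurableT.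
  by rewrite preimage_setT setTI probability_setT mul1e.
have mZ B0 : measurable B0 -> measurable (Z n @^-1` B0).
  by move=> mB0; apply: mpre => //; exact: measurable_chain.
have step1 B0 B3 C12 : measurable B0 -> measurable B3 -> measurable C12 ->
    P ((fun w => (L n w, Rr n w) : M * M) @^-1` C12 `&` (Z n @^-1` B0 `&` (U n @^-1` B3 `&` F))) =
    jump_law bl br C12 * P (Z n @^-1` B0 `&` (U n @^-1` B3 `&` F)).
  move=> mB0 mB3 mC12; apply: pair_law => //.
    apply: measurableI; first exact: mZ.
    by apply: measurableI => //; exact: mpre.
  move=> B1 B2 mB1 mB2; rewrite rect3//.
  rewrite (_ : _ `&` _ = Z n @^-1` B0 `&` (L n @^-1` B1 `&` (Rr n @^-1` B2 `&`
    (U n @^-1` B3 `&` F)))); last by apply/seteqP; split => w /=; tauto.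
  by rewrite rect// -muleA [LHS]muleCA [m B0 * (br B2 * _)]muleCA.
have step2 B0 C : measurable B0 -> measurable C ->
    P (V n @^-1` C `&` (Z n @^-1` B0 `&` F)) = innovation_law bl br C * P (Z n @^-1` B0 `&` F).
  move=> mB0 mC; apply: pair_law => //.
  - exact: measurable_fun_pair.
  - by apply: measurableI => //; exact: mZ.
  move=> C12 B3 mC12 mB3.
  rewrite (_ : _ `&` _ = (fun w => (L n w, Rr n w) : M * M) @^-1` C12 `&`
    (Z n @^-1` B0 `&` (U n @^-1` B3 `&` F))); last by apply/seteqP; split => w /=; tauto.
  by rewrite step1// rect3// rect4// -muleA; congr (_ * _); rewrite muleCA.
move=> C mC; apply: (@pair_law _ _ _ P _ _ _ _ (Z n) (V n) F _ _ _ m (innovation_law bl br)) => //.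
- exact: measurable_chain.
- move=> B0 C' mB0 mC'.
  rewrite (_ : _ `&` _ = V n @^-1` C' `&` (Z n @^-1` B0 `&` F)); last first.
    by apply/seteqP; split => w /=; tauto.
  by rewrite step2// rect4// muleCA muleA.
Qed.

Let indep_futureP n : indep_future n.
Proof.
elim: n => [|n IHn] J A B uJ nJ mA mB.
  have [x0B|x0B] := pselect (B x0).
    rewrite (_ : Z 0%N @^-1` B = setT) ?setTI ?probability_setT ?mul1e//.
    by apply/seteqP; split.
  rewrite (_ : Z 0%N @^-1` B = set0) ?set0I ?measure0 ?mul0e//.
  by apply/seteqP; split.
have mC : measurable (step p @^-1` B).
  by rewrite -[X in measurable X]setTI; exact: measurable_step.
have XE : Z n.+1 @^-1` B = (fun w => (Z n w, V n w)) @^-1` (step p @^-1` B) by [].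
rewrite XE joint_law//; congr (_ * _).
have := @joint_law n IHn [::] (fun=> setT) isT isT (fun _ _ => measurableT) _ mC.
by rewrite /innovation_event bigcap_seq big_nil setIT probability_setT mule1.
Qed.

(** The state at time [n] and the next triple of innovations are independent. *)
Lemma chain_law_evolves n A : measurable A ->
  P (Z n.+1 @^-1` A) =
  \int[pushforward P (Z n)]_x innovation_law bl br [set v | A (step p (x, v))].
Proof.
move=> mA; have mC : measurable (step p @^-1` A).
  by rewrite -[X in measurable X]setTI; exact: measurable_step.
have := @joint_law n (@indep_futureP n) [::] (fun=> setT) isT isT (fun _ _ => measurableT) _ mC.
rewrite /innovation_event bigcap_seq big_nil setIT probability_setT mule1 => ->.
rewrite /product_measure1; apply: eq_integral; first exact: measurable_chain.
move=> x _ /=; congr (innovation_law bl br _).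
by apply/seteqP; split => v; rewrite /xsection/= inE.
Qed.

End chain_law.

(** * Ergodicity *)

Section piecewise.
Context {R : realType}.

(** Off the exceptional points [f] is continuous, and these form a finite set. *)
Lemma piecewise_continuous_measurable (a b : R) (f : R -> R) :
  piecewise_continuous_on a b f -> measurable_fun `[a, b] f.
Proof.
move=> [s [fs _]].
pose S : set R := [set` s].
have cS : countable S by apply: finite_set_countable; exact: finite_seq.
have mC (A : set R) : A `<=` S -> measurable A.
  move=> AS; apply: countable_measurable; first exact: measurable_set1.
  by apply: sub_countable cS; exact: subset_card_le.
have mAS : measurable (`[a, b]%classic `\` S) by apply: measurableD => //; exact: mC.
rewrite -(setUIDK `[a, b]%classic S); apply/measurable_funU => //.
  by apply: mC => x [].
split; first by move=> _ Z _; apply: mC => x [[]].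
apply: subspace_continuous_measurable_fun => //.
apply/subspace_continuousP => x [/= xab xs].
have := fs x xab; move=> /(_ (introN idP xs)) fx.
apply: cvg_trans fx; apply: cvg_app.
apply: within_subset; exact: subDsetl.
Qed.

End piecewise.

Section density_measure.
Local Open Scope ereal_scope.
Context d (T : measurableType d) (R : realType) (mu : {measure set T -> \bar R}).
Variables (q : T -> R) (q0 : forall x, (0 <= q x)%R) (mq : measurable_fun setT q).

(** The proofs are arguments so that the measure structure can be attached to the
definition. *)
Definition density_measure of (forall x, (0 <= q x)%R) & measurable_fun setT q :=
  fun A : set T => \int[mu]_(x in A) (q x)%:E.

Local Notation W := (density_measure q0 mq).

Let W0 : W set0 = 0.
Proof. by rewrite /density_measure integral_set0. Qed.

Let W_ge0 A : 0 <= W A.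
Proof. by apply: integral_ge0 => x _; rewrite lee_fin. Qed.

Let W_sigma_additive : semi_sigma_additive W.
Proof.
move=> /= F mF tF mUF; rewrite /density_measure; apply: cvg_toP.
  apply: ereal_nondecreasing_is_cvgn => m n mn.
  by apply: lee_sum_nneg_natr => // k _ _; exact: W_ge0.
rewrite ge0_integral_bigcup//=.
- by apply: measurable_funTS; exact/measurable_EFinP.
- by move=> x _; rewrite lee_fin.
Qed.

HB.instance Definition _ := isMeasure.Build _ _ _ W W0 W_ge0 W_sigma_additive.

End density_measure.

Lemma mnormalize_mass1 d (T : measurableType d) (R : realType)
    (m : {measure set T -> \bar R}) (P : probability T R) A :
  m setT = 1%E -> mnormalize m P A = m A.
Proof. by move=> mT; rewrite /mnormalize mT onee_eq0/= invr1 mule1. Qed.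

Section ergodicity.
Context {R : realType}.
Local Notation mu := (@lebesgue_measure R).
Local Notation M := (measurableTypeR R).
Variables (l r : R) (p : R -> R).
Hypotheses (hl : 0 < l) (hr : 0 < r).
Hypothesis p01 : forall x, 0 <= x <= 1 -> 0 <= p x <= 1.
Hypothesis mp : measurable_fun `[(0 : R), 1] p.
Variables delta eps : R.
Hypothesis hdelta : 0 < delta < 1 / 2.
Hypothesis heps : 0 < eps <= 1 / 2.
Hypothesis p_left : forall x, 0 <= x <= delta -> p x <= 1 - eps.
Hypothesis p_right : forall x, 1 - delta <= x <= 1 -> eps <= p x.

Local Notation nu := (innovation_law (beta1_law hl) (beta1_law hr)).
Local Notation D := (`[(0 : R), 1]%classic : set M).
Local Notation K := (random_map_op nu (step p)).
Local Notation w := (weight l r p).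

Let mD : measurable D. Proof. exact: measurable_itv. Qed.

Let D01 x : D x -> 0 <= x <= 1. Proof. by rewrite /= in_itv. Qed.

Lemma walk_contraction : exists2 a : R, 0 <= a < 1 &
  forall m m' : nat -> probability M R,
  evolves nu (step p) m -> evolves nu (step p) m' ->
  m 0%N D = 1%E -> m' 0%N D = 1%E -> forall n A, measurable A ->
  (`|m n A - m' n A| <= (a ^+ n./2)%:E)%E.
Proof.
have [d0 d1] := andP hdelta; have [e0 e1] := andP heps.
pose c := (eps * density_floor l r delta) ^+ 2 * (delta / 2).
have c0 : 0 < c.
  rewrite mulr_gt0 ?divr_gt0// exprn_gt0// mulr_gt0//; exact: density_floor_gt0.
pose cn : {nonneg R} := NngNum (ltW c0).
pose rho := mscale cn mu.
pose B : set M := `]delta, (1 - delta)[%classic.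
have mB : measurable B by exact: measurable_itv.
have BD : B `<=` D.
  by move=> x; rewrite /B/= !in_itv/= => /andP[dx xd]; apply/andP; split; lra.
have gD x : D x -> {ae nu, forall v, D (step p (x, v))}.
  by move=> /D01 x01; exact: step_in01.
have minor f : measurable_fun setT f -> (forall x, 0 <= f x)%E ->
    forall x, D x -> (\int[rho]_(y in B) f y <= K (K f) x)%E.
  move=> mf f0 x /D01 x01; rewrite /rho ge0_integral_mscale//; last exact: measurable_funTS.
  exact: (two_step_minorization hl hr p01 mp hdelta heps p_left p_right).
have rhoB : rho B = (c * (1 - delta - delta))%:E.
  rewrite /rho /mscale/= lebesgue_measure_itv/= lte_fin ifT; last by lra.
  by rewrite -EFinB -EFinM.
exists (1 - fine (rho B)).
  rewrite rhoB/= subr_ge0 -lee_fin -rhoB.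
  rewrite (minorizing_mass_le1 mB minor (x := 0)); last by rewrite /= in_itv/= lexx ler01.
  by rewrite ltrBlDr ltrDl mulr_gt0//; lra.
move=> m m' em em' mD1 m'D1 n A mA.
exact: (doeblin_evolves (measurable_step mp) mD gD mB BD minor).
Qed.

Let transition_measurable A : measurable A ->
  measurable_fun setT (fun x : M => nu [set v | A (step p (x, v))]).
Proof.
move=> mA; rewrite (_ : (fun x => _) = K (EFin \o \1_A)); last first.
  by apply/funext => x; rewrite random_map_op_indic//; exact: measurable_step.
apply: measurable_random_map_op.
- exact: measurable_step.
- exact/measurable_EFinP/measurable_indic.
- by move=> x; rewrite lee_fin.
Qed.

(** A stationary law is one whose constant sequence evolves with the chain. *)
Let stationaryP (Pi : probability M R) : Pi D = 1%E ->
  (stationary (transition l r p) Pi <-> evolves nu (step p) (fun=> Pi)).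
Proof.
move=> PD; have full A : measurable A ->
    (\int[Pi]_x nu [set v | A (step p (x, v))] =
     \int[Pi]_(x in `[0%R, 1%R]) transition l r p x A)%E.
  by move=> mA; apply: integral_probability_full => //; exact: transition_measurable.
split=> [[_ st] n A mA|ev]; first by rewrite full// st.
by split => // A mA; rewrite -full// -(ev 0%N).
Qed.

Lemma stationary_unique (Pi Pi' : probability M R) :
  stationary (transition l r p) Pi -> stationary (transition l r p) Pi' ->
  forall A, measurable A -> Pi' A = Pi A.
Proof.
move=> st st' A mA; have [PD _] := st; have [P'D _] := st'.
have [a /andP[a0 a1] contr] := walk_contraction.
have bound n := contr _ _ ((stationaryP P'D).1 st') ((stationaryP PD).1 st) P'D PD n.*2 A mA.
have Pf : Pi A \is a fin_num by exact: fin_num_measure.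
have P'f : Pi' A \is a fin_num by exact: fin_num_measure.
move: bound; rewrite -(fineK Pf) -(fineK P'f) -EFinB abse_EFin => bound.
congr EFin; apply/eqP; rewrite -subr_eq0 -normr_le0 leNgt; apply/negP => gap.
have a_cvg : a ^+ n @[n --> \oo] --> 0 by apply: cvg_expr; rewrite ger0_norm.
have [N _ aN] : \forall n \near \oo, a ^+ n < `|fine (Pi' A) - fine (Pi A)|.
  exact: (cvgr_lt _ a_cvg).
have := bound N; rewrite doubleK lee_fin leNgt => /negP; apply.
exact: (aN N (leqnn N)).
Qed.

Lemma walk_converges (m : nat -> probability M R) (Pi : probability M R) :
  evolves nu (step p) m -> m 0%N D = 1%E -> stationary (transition l r p) Pi ->
  total_variation_dist (m n) Pi @[n --> \oo] --> 0%E.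
Proof.
move=> em mD1 st; have [PD _] := st.
have [a /andP[a0 a1] contr] := walk_contraction.
apply: (@squeeze_cvge _ _ _ _ (cst 0%E) _ (fun n => (a ^+ n./2)%:E)).
- apply: nearW => n; apply/andP; split.
    by apply: ereal_sup_ubound; exists set0 => //; rewrite !measure0 subee// abse0.
  apply: ge_ereal_sup => _ [A mA <-].
  exact: (contr _ _ em ((stationaryP PD).1 st) mD1 PD).
- exact: cvg_cst.
- apply: cvg_EFin; first exact: nearW.
  have a_cvg : a ^+ n @[n --> \oo] --> 0 by apply: cvg_expr; rewrite ger0_norm.
  apply: (cvg_comp half (fun n => a ^+ n) _ a_cvg).
  move=> /= S [N _ NS]; exists N.*2 => // n /= Nn; apply: NS => /=.
  by rewrite -(doubleK N) half_leq.
Qed.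

Definition normalisation : R := (fine (\int[mu]_(x in `]0%R, 1%R[) (w x)%:E))^-1.

Let heps1 : 0 < eps <= 1.
Proof. by have /andP[e0 e1] := heps; apply/andP; split; lra. Qed.

Let I : \bar R := (\int[mu]_(x in `]0%R, 1%R[) (w x)%:E)%E.

Let I_lty : (I < +oo)%E.
Proof. exact: integral_weight_lty p_left p_right. Qed.

Let I_gt0 : (0 < I)%E.
Proof. exact: integral_weight_gt0 p_right. Qed.

Let I_fin : I \is a fin_num.
Proof. by rewrite ge0_fin_numE// ltW. Qed.

Lemma normalisation_gt0 : 0 < normalisation.
Proof. by rewrite invr_gt0 fine_gt0// I_gt0. Qed.

Let density (x : M) : R := (fun x => normalisation * w x) \_ (`]0, 1[%classic : set R) x.

Let density0 x : 0 <= density x.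
Proof.
rewrite /density patchE; case: ifPn => // /set_mem; rewrite /= in_itv/= => x01.
by rewrite mulr_ge0// ltW ?normalisation_gt0// weight_gt0.
Qed.

Let mdensity : measurable_fun setT density.
Proof.
apply/(measurable_restrictT (fun x => normalisation * w x)) => //.
by apply: measurable_funM => //; exact: measurable_weight.
Qed.

Let integral_density (f : M -> \bar R) : measurable_fun setT f -> (forall x, 0 <= f x)%E ->
  (\int[mu]_x (f x * (density x)%:E) =
   normalisation%:E * \int[mu]_(x in `]0%R, 1%R[) (f x * (w x)%:E))%E.
Proof.
move=> mf f0; rewrite -ge0_integralZl//; last 3 first.
- apply: emeasurable_funM; first exact: measurable_funTS.
  by apply/measurable_EFinP; exact: measurable_weight.
- move=> x; rewrite /= in_itv/= => x01; apply: mule_ge0 => //.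
  by rewrite lee_fin ltW// weight_gt0.
- by rewrite lee_fin ltW// normalisation_gt0.
rewrite [RHS]integral_mkcond; apply: eq_integral => x _.
rewrite /density !patchE; case: ifPn => _; last by rewrite mule0.
by rewrite EFinM muleCA.
Qed.

Let W := density_measure mu density0 mdensity.

Let WE A : measurable A -> W A =
  (normalisation%:E * \int[mu]_(x in `]0%R, 1%R[) ((\1_A x)%:E * (w x)%:E))%E.
Proof.
move=> mA; rewrite -(integral_density (f := EFin \o \1_A)); last 2 first.
- exact/measurable_EFinP/measurable_indic.
- by move=> x; rewrite lee_fin.
rewrite /W /density_measure integral_mkcond; apply: eq_integral => x _.
by rewrite patchE /= indicE; case: ifP; rewrite ?mul1e ?mul0e.
Qed.

Let WT : W setT = 1%E.
Proof.
rewrite WE//; under eq_integral do rewrite indicT mul1e.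
by rewrite -[X in (_ * X)%E]fineK// -EFinM mulVf// gt_eqF// fine_gt0// I_gt0.
Qed.

(** The measure to be normalised already has mass one; normalising it packs it as a
probability. *)
Definition stationary_law : probability M R :=
  mnormalize (density_measure mu density0 mdensity) (beta1_law hl).

Let stationary_lawE A : stationary_law A = W A.
Proof.
exact: mnormalize_mass1 WT.
Qed.

Lemma stationary_law_density A : measurable A ->
  (stationary_law A = \int[mu]_(x in A `&` `]0%R, 1%R[)
     (stationary_density l r p normalisation x)%:E)%E.
Proof.
move=> mA; rewrite stationary_lawE /W /density_measure integral_mkcondr.
apply: eq_integral => x _; rewrite /density !patchE.
by case: ifP => // _; rewrite stationary_densityE.
Qed.

Lemma stationary_law_stationary : stationary (transition l r p) stationary_law.
Proof.
have PD : stationary_law D = 1%E.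
  rewrite stationary_lawE -WT !WE//; congr (_ * _)%E; apply: eq_integral => x.
  rewrite inE/= in_itv/= => /andP[x0 x1]; rewrite indicT indicE mem_set//=.
  by rewrite in_itv/= !ltW.
apply/(stationaryP PD) => n A mA.
have m1 : measurable_fun [set: M] (EFin \o (\1_A : M -> R)).
  exact/measurable_EFinP/measurable_indic.
have p1 (x : M) : (0 <= (EFin \o (\1_A : M -> R)) x)%E.
  by rewrite lee_fin.
rewrite (ge0_integral_density density0 mdensity (mu := mu)); last 3 first.
- by move=> B mB; exact: stationary_lawE.
- exact: transition_measurable.
- by move=> x; exact: measure_ge0.
rewrite stationary_lawE integral_density; last 2 first.
- exact: transition_measurable.
- by move=> x; exact: measure_ge0.
rewrite WE//; congr (_ * _)%E.
rewrite -(weight_invariant hl hr p01 mp hdelta heps1 p_left p_right m1 p1).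
by apply: eq_integral => x _; rewrite random_map_op_indic//; exact: measurable_step.
Qed.

End ergodicity.

(** The margin is capped by 1/2: then, at a point of the middle zone, one of the two
directions has probability at least [eps]. *)
Lemma drift_margin (R : realType) (p : R -> R) (delta : R) :
  (forall x : R, x \in `[0, 1] -> p x \in `[0, 1]) -> 0 < delta < 1 / 2 ->
  sup [set Num.max (p x) (1 - p (1 - x)) | x in `[0, delta]] < 1 ->
  exists eps : R, [/\ 0 < eps <= 1 / 2,
    forall x, 0 <= x <= delta -> p x <= 1 - eps &
    forall x, 1 - delta <= x <= 1 -> eps <= p x].
Proof.
move=> hp01 /andP[d0 d1]; set S := [set _ | _ in _] => supS.
have ubS : has_ubound S.
  exists 1 => _ [x /= + <-]; rewrite in_itv/= => /andP[x0 xd].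
  have h1 : p x \in `[0, 1] by apply: hp01; rewrite in_itv/=; lra.
  have h2 : p (1 - x) \in `[0, 1] by apply: hp01; rewrite in_itv/=; lra.
  by move: h1 h2; rewrite !in_itv/= ge_max => /andP[_ ->] /andP[p0 _]; rewrite gerBl.
have leS x : 0 <= x <= delta -> Num.max (p x) (1 - p (1 - x)) <= sup S.
  by move=> xd; apply: ub_le_sup => //; exists x => //=; rewrite in_itv.
exists (Num.min (1 / 2) (1 - sup S)); split.
- by rewrite lt_min subr_gt0 supS ge_min lexx divr_gt0.
- move=> x /leS; rewrite ge_max => /andP[px _].
  by rewrite lerBrDr -lerBrDl ge_min; apply/orP; right; rewrite lerB.
- move=> x /andP[dx x1]; have /leS : 0 <= 1 - x <= delta by lra.
  rewrite ge_max => /andP[_]; rewrite subKr => px.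
  by rewrite ge_min; apply/orP; right; rewrite lerBlDl -lerBlDr.
Qed.

Theorem theorem2 (R : realType) (l r : R) (hl : 0 < l) (hr : 0 < r)
  (p : R -> R)
  (hp01 : forall x : R, x \in `[0, 1] -> p x \in `[0, 1])
  (hpc : piecewise_continuous_on 0 1 p)
  (delta : R) (hdelta : 0 < delta < 1 / 2)
  (hsup : sup [set Num.max (p x) (1 - p (1 - x)) | x in `[0, delta]] < 1)
  (d : measure_display) (Omega : measurableType d) (P : probability Omega R)
  (L Rr U : nat -> {RV P >-> R})
  (hind : mutually_independent (innovations L Rr U))
  (hL : forall n A, measurable A -> distribution P (L n) A = rbeta_law 1 l A)
  (hR : forall n A, measurable A -> distribution P (Rr n) A = rbeta_law 1 r A)
  (hU : forall n A, measurable A ->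
          distribution P (U n) A = uniform_prob (@ltr01 R) A) :
  exists C : R,
    [/\ 0 < C,
        (\int[lebesgue_measure]_(x in `]0%R, 1%R[)
           (stationary_density l r p C x)%:E = 1)%E &
        exists Pi : probability (measurableTypeR R) R,
          ergodic_with (transition l r p)
            (fun x n => pushforward P (chain p L Rr U x n)) Pi /\
          forall A, measurable A ->
            Pi A = (\int[lebesgue_measure]_(x in A `&` `]0%R, 1%R[)
                      (stationary_density l r p C x)%:E)%E].
Proof.
have [eps [heps p_left p_right]] := drift_margin hp01 hdelta hsup.
have p01 x : 0 <= x <= 1 -> 0 <= p x <= 1.
  by move=> x01; have := hp01 x; rewrite !in_itv/=; exact.
have mp := piecewise_continuous_measurable hpc.
pose Pi := stationary_law hl hr p01 mp hdelta heps p_left p_right.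
have PiE := stationary_law_density hl hr p01 mp hdelta heps p_left p_right.
have st : stationary (transition l r p) Pi by exact: stationary_law_stationary.
exists (normalisation l r p); split.
- exact: (normalisation_gt0 hl hr p01 mp hdelta heps p_left p_right).
- by rewrite -[X in integral _ X _]setTI -PiE// probability_setT.
exists Pi; split; last exact: PiE.
split => //.
- move=> Pi' st' A mA.
  exact: (stationary_unique hl hr p01 mp hdelta heps p_left p_right st st').
move=> x; rewrite in_itv/= => x01.
pose m n : probability (measurableTypeR R) R := distribution P
  (HB.pack (chain p L Rr U x n : Omega -> measurableTypeR R)
    (isMeasurableFun.Build _ _ _ _ _ (measurable_chain mp L Rr U x n))
   : {mfun Omega >-> measurableTypeR R}).
have em : evolves (innovation_law (beta1_law hl) (beta1_law hr)) (step p) m.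
  move=> n A mA.
  exact: (chain_law_evolves mp hind (bl := beta1_law hl) (br := beta1_law hr) hL hR hU x n mA).
have m01 : m 0%N `[(0 : R), 1]%classic = 1%E.
  transitivity (P setT); last exact: probability_setT.
  by congr (P _); apply/seteqP; split => // w _ /=; rewrite in_itv.
exact: (walk_converges p01 mp hdelta heps p_left p_right em m01 st).
Qed.
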